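(* Let $R_n$ be the rook monoid and let $\mathcal{C}^{\lfloor s\rfloor}(R_n)$ denote the minimum, over all complete sets $\mathcal{Y}$ of inequivalent irreducible matrix representations of $\mathbb{C}R_n$, of the minimal number of operations needed to compute the Fourier transform (with respect to $\mathcal Y$) of an arbitrary element of $\mathbb{C}R_n$ given by its coefficients in the groupoid basis $\{\lfloor s\rfloor\}_{s\in R_n}$. Then, as $n\to\infty$, $$\mathcal{C}^{\lfloor s\rfloor}(R_n)\le O\big(|R_n|\log^2|R_n|\big).$$
   Context: The rook monoid $R_n$ is the monoid of all partial injective maps of $\{1,\dots,n\}$ (bijections between subsets of $\{1,\dots,n\}$), under composition of partial functions; maps act on the left. The rank of $s\in R_n$ is $\mathrm{rk}(s)=|\mathrm{dom}(s)|$. Write $t\le s$ if $t$ is a restriction of $s$ (equivalently $t=es$ for some idempotent $e$). The semigroup algebra $\mathbb{C}R_n$ has basis $\{s\}_{s\in R_n}$ with multiplication extended linearly from $R_n$; it is semisimple. Its groupoid basis is $\{\lfloor s\rfloor\}_{s\in R_n}$, where $\lfloor s\rfloor=\sum_{t\le s}(-1)^{\mathrm{rk}(t)-\mathrm{rk}(s)}\,t$ (equivalently $s=\sum_{t\le s}\lfloor t\rfloor$). A matrix representation of $\mathbb{C}R_n$ is an algebra homomorphism $\rho:\mathbb{C}R_n\to M_{d_\rho}(\mathbb{C})$. It is irreducible if the associated module is non-null and simple. Two representations are equivalent if they are conjugate by an invertible matrix. A complete set of inequivalent irreducible matrix representations contains exactly one representative of each equivalence class of irreducible representations. For such a set $\mathcal{Y}$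 and $f=\sum_{s\in R_n}f(s)\lfloor s\rfloor$ with arbitrary complex coefficients $f(s)$, computing the Fourier transform of $f$ means computing the matrices $\hat f(\rho)=\sum_{s\in R_n}f(s)\rho(\lfloor s\rfloor)$ for all $\rho\in\mathcal{Y}$ from the input $(f(s))_{s\in R_n}$. The minimal number of operations to do this is denoted $\mathcal{T}^{\lfloor s\rfloor}_{\mathcal{Y}}(R_n)$, and $\mathcal{C}^{\lfloor s\rfloor}(R_n)=\min_{\mathcal{Y}}\mathcal{T}^{\lfloor s\rfloor}_{\mathcal{Y}}(R_n)$. An operation is a single complex multiplication followed by a complex addition; the representations in $\mathcal Y$ are assumed precomputed and stored in memory. Concretely, one counts the steps of a straight-line program, each step forming $a\cdot b+c$ where each of $a,b,c$ is an input $f(s)$, a complex constant, or the result of an earlier step; copying or arranging already computed numbers is free. *)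

(* Defs.v *)
From HB Require Import structures.
From mathcomp Require Import all_boot all_order all_algebra.
From mathcomp Require Import all_classical all_reals all_analysis.
From mathcomp Require Import complex.
Set Implicit Arguments.
Unset Strict Implicit.
Unset Printing Implicit Defensive.
Import Order.TTheory GRing.Theory Num.Theory.
Local Open Scope ring_scope.

(* A partial map of {1, .., n} is a total map to [option 'I_n], the value [None]
   meaning "undefined". *)
Definition pdom n (s : {ffun 'I_n -> option 'I_n}) : {set 'I_n} :=
  [set x | s x != None].

Record rook (n : nat) := Rook {
  rook_val :> {ffun 'I_n -> option 'I_n};
  rook_inj : dinjectiveb rook_val (pdom rook_val) }.

HB.instance Definition _ n := [isSub for @rook_val n].
HB.instance Definition _ n := [Finite of rook n by <:].

Definition rank n (s : rook n) : nat := #|pdom s|.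

Definition rook_le n (t s : rook n) : bool := [forall x in pdom t, t x == s x].

Section RookMonoid.
Variable n : nat.
Implicit Types s t u : rook n.

Lemma rook_injP s x y : s x != None -> s x = s y -> x = y.
Proof.
move=> sx sxy; apply: (dinjectiveP _ _ (rook_inj s)) => //; rewrite inE //.
by rewrite -sxy.
Qed.

Fact rook_one_subproof :
  let e := [ffun x : 'I_n => Some x] in dinjectiveb e (pdom e).
Proof. by apply/dinjectiveP => x y _ _; rewrite !ffunE => -[]. Qed.

Definition rook_one : rook n := Rook rook_one_subproof.

Fact rook_mul_subproof s t :
  let c := [ffun x => obind s (t x)] in dinjectiveb c (pdom c).
Proof.
apply/dinjectiveP => x y; rewrite !inE !ffunE.
case tx: (t x) => [a|] //=; case ty: (t y) => [b|] //= sa _ /(rook_injP sa) ab.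
by apply: (@rook_injP t); rewrite tx // ty ab.
Qed.

(* Maps act on the left: [rook_mul s t] applies [t] first. *)
Definition rook_mul s t : rook n := Rook (rook_mul_subproof s t).

Fact rook_mulA : associative rook_mul.
Proof.
move=> s t u; apply/val_inj/ffunP => x; rewrite !ffunE.
by case: (u x) => [a|] //=; rewrite ffunE.
Qed.

Fact rook_mul1 : left_id rook_one rook_mul.
Proof.
move=> s; apply/val_inj/ffunP => x; rewrite !ffunE.
by case: (s x) => [a|] //=; rewrite ffunE.
Qed.

Fact rook_mulr1 : right_id rook_one rook_mul.
Proof. by move=> s; apply/val_inj/ffunP => x; rewrite !ffunE. Qed.

HB.instance Definition _ :=
  isMonoid.Build (rook n) rook_mulA rook_mul1 rook_mulr1.

End RookMonoid.

Definition rook_algebra (K : fieldType) (n : nat) := {ffun rook n -> K}.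

Section RookAlgebra.
Variables (K : fieldType) (n : nat).
Local Notation A := (rook_algebra K n).
Implicit Types (s t u : rook n) (f g h : A).

HB.instance Definition _ := GRing.Zmodule.on A.
HB.instance Definition _ := GRing.Lmodule.copy A {ffun rook n -> K^o}.

Definition rook_basis s : A := [ffun t => (t == s)%:R].

Definition alg_mul f g : A :=
  \sum_s \sum_t (f s * g t) *: rook_basis (s * t)%g.

Lemma rook_basis_sum f : f = \sum_s f s *: rook_basis s.
Proof.
apply/ffunP => u; rewrite sum_ffunE (bigD1 u) //= !ffunE eqxx /= big1 ?addr0.
  by rewrite [LHS](esym (mulr1 _)).
by move=> s su; rewrite !ffunE eq_sym (negPf su) scaler0.
Qed.

Lemma alg_mulDl f g h : alg_mul (f + g) h = alg_mul f h + alg_mul g h.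
Proof.
rewrite -big_split; apply: eq_bigr => s _ /=; rewrite -big_split.
by apply: eq_bigr => t _ /=; rewrite ffunE mulrDl scalerDl.
Qed.

Lemma alg_mulDr f g h : alg_mul f (g + h) = alg_mul f g + alg_mul f h.
Proof.
rewrite -big_split; apply: eq_bigr => s _ /=; rewrite -big_split.
by apply: eq_bigr => t _ /=; rewrite ffunE mulrDr scalerDl.
Qed.

Lemma alg_mulZl a f g : alg_mul (a *: f) g = a *: alg_mul f g.
Proof.
rewrite scaler_sumr; apply: eq_bigr => s _; rewrite scaler_sumr.
by apply: eq_bigr => t _; rewrite ffunE scalerA mulrA.
Qed.

Lemma alg_mulZr a f g : alg_mul f (a *: g) = a *: alg_mul f g.
Proof.
rewrite scaler_sumr; apply: eq_bigr => s _; rewrite scaler_sumr.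
by apply: eq_bigr => t _; rewrite ffunE scalerA mulrCA.
Qed.

Lemma alg_mul0l g : alg_mul 0 g = 0.
Proof. by have := alg_mulZl 0 0 g; rewrite !scale0r. Qed.

Lemma alg_mul0r f : alg_mul f 0 = 0.
Proof. by have := alg_mulZr 0 f 0; rewrite !scale0r. Qed.

Lemma alg_mul_suml (I : finType) (F : I -> A) g :
  alg_mul (\sum_i F i) g = \sum_i alg_mul (F i) g.
Proof.
by elim/big_rec2: _ => [|i y1 y2 _ <-]; rewrite ?alg_mul0l ?alg_mulDl.
Qed.

Lemma alg_mul_sumr (I : finType) f (F : I -> A) :
  alg_mul f (\sum_i F i) = \sum_i alg_mul f (F i).
Proof.
by elim/big_rec2: _ => [|i y1 y2 _ <-]; rewrite ?alg_mul0r ?alg_mulDr.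
Qed.

Lemma alg_mul_basis s t :
  alg_mul (rook_basis s) (rook_basis t) = rook_basis (s * t)%g.
Proof.
rewrite /alg_mul (bigD1 s) //= (bigD1 t) //= !ffunE !eqxx mulr1 scale1r.
rewrite !big1 ?addr0 // => [u us | u ut].
  by apply: big1 => v _; rewrite !ffunE (negPf us) mul0r scale0r.
by rewrite !ffunE (negPf ut) mulr0 scale0r.
Qed.

Fact alg_mulA : associative alg_mul.
Proof.
move: alg_mul alg_mul_suml alg_mul_sumr alg_mulZl alg_mulZr alg_mul_basis.
move=> mul suml sumr Zl Zr mul_basis f g h.
rewrite (rook_basis_sum f) !suml.
apply: eq_bigr => s _; rewrite !Zl; congr (_ *: _).
rewrite (rook_basis_sum g) sumr !suml sumr.
apply: eq_bigr => t _; rewrite !(Zl, Zr); congr (_ *: _).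
rewrite (rook_basis_sum h) !sumr.
by apply: eq_bigr => u _; rewrite !Zr !mul_basis mulgA.
Qed.

Fact alg_mul1 : left_id (rook_basis 1%g) alg_mul.
Proof.
move=> f; rewrite {1}(rook_basis_sum f) alg_mul_sumr [RHS]rook_basis_sum.
by apply: eq_bigr => s _; rewrite alg_mulZr alg_mul_basis mul1g.
Qed.

Fact alg_mulr1 : right_id (rook_basis 1%g) alg_mul.
Proof.
move=> f; rewrite {1}(rook_basis_sum f) alg_mul_suml [RHS]rook_basis_sum.
by apply: eq_bigr => s _; rewrite alg_mulZl alg_mul_basis mulg1.
Qed.

Fact rook_basis1_neq0 : rook_basis 1%g != 0.
Proof.
by apply/eqP => /ffunP/(_ 1%g)/eqP; rewrite !ffunE eqxx oner_eq0.
Qed.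

HB.instance Definition _ := GRing.Zmodule_isNzRing.Build A
  alg_mulA alg_mul1 alg_mulr1 alg_mulDl alg_mulDr rook_basis1_neq0.
HB.instance Definition _ := GRing.Lmodule_isLalgebra.Build K A
  (fun a f g => esym (alg_mulZl a f g)).
HB.instance Definition _ := GRing.Lalgebra_isAlgebra.Build K A
  (fun a f g => esym (alg_mulZr a f g)).

(* Since t <= s gives rk t <= rk s, the sign (-1)^(rk t - rk s) has the natural
   exponent rk s - rk t. *)
Definition groupoid_basis s : A :=
  \sum_(t | rook_le t s) (-1) ^+ (rank s - rank t) *: rook_basis t.

End RookAlgebra.

(* Algebra homomorphisms are not required to be unital. *)
Record mxrep (K : fieldType) (n : nat) := MxRep {
  mxrep_dim : nat;
  mxrep_fun :> {linear rook_algebra K n -> 'M[K]_mxrep_dim};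
  mxrepM : {morph mxrep_fun : a b / a * b >-> a *m b} }.

Section Representations.
Variables (K : fieldType) (n : nat).
Implicit Types rho sigma : mxrep K n.

(* The module of [rho] is the space of column vectors, with a.v = rho(a) v. *)
Definition submodule rho (U : {vspace 'cV[K]_(mxrep_dim rho)}) : Prop :=
  forall a v, v \in U -> rho a *m v \in U.

Definition non_null rho : Prop :=
  exists a, exists v : 'cV[K]_(mxrep_dim rho), rho a *m v != 0.

Definition simple_module rho : Prop :=
  (0 < mxrep_dim rho)%N /\
  forall U, submodule (rho := rho) U -> U = 0%VS \/ U = fullv.

Definition mxrep_irr rho : Prop := non_null rho /\ simple_module rho.

(* The two-sided inverse [Q] of [P] forces the dimensions to agree. *)
Definition mxrep_equiv rho sigma : Prop :=
  exists (P : 'M[K]_(mxrep_dim sigma, mxrep_dim rho))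
         (Q : 'M[K]_(mxrep_dim rho, mxrep_dim sigma)),
    [/\ P *m Q = 1%:M, Q *m P = 1%:M & forall a, sigma a = P *m rho a *m Q].

Definition complete_irr_set (Y : set (mxrep K n)) : Prop :=
  (forall rho, Y rho -> mxrep_irr rho) /\
  (forall rho, mxrep_irr rho -> exists! sigma, Y sigma /\ mxrep_equiv rho sigma).

Definition groupoid_fourier (f : rook n -> K) rho : 'M[K]_(mxrep_dim rho) :=
  \sum_s f s *: rho (groupoid_basis K s).

End Representations.

(* Straight-line programs with inputs indexed by [I]. The instruction (a, b, c)
   performs one operation, a * b + c. [Step j] is the result of the j-th
   instruction, counted from 0; when that instruction has not been performed it
   reads 0, which gives no extra power as 0 is also available as a constant. *)
Inductive operand (I K : Type) := Input of I | Const of K | Step of nat.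
Arguments Input {I K} _.
Arguments Const {I K} _.
Arguments Step {I K} _.

Definition instruction (I K : Type) : Type :=
  operand I K * operand I K * operand I K.

Section StraightLine.
Variables (I : Type) (K : pzRingType).
Implicit Types (f : I -> K) (P : seq (instruction I K)) (r : seq K).

Definition read f r (o : operand I K) : K :=
  match o with
  | Input i => f i
  | Const c => c
  | Step j => r`_j
  end.

Definition perform f r (q : instruction I K) : seq K :=
  let: (a, b, c) := q in rcons r (read f r a * read f r b + read f r c).

Definition results f P : seq K := foldl (perform f) [::] P.

End StraightLine.

Definition is_minimum (S : set nat) (m : nat) : Prop :=
  S m /\ forall k, S k -> (m <= k)%N.

Section Complexity.
Variables (K : fieldType) (n : nat).
Implicit Types Y : set (mxrep K n).

(* Outputs are selected among inputs, constants and results at no cost, uniformly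
   in the input [f]. *)
Definition computes_fourier Y (P : seq (instruction (rook n) K)) : Prop :=
  forall rho, Y rho -> forall i j, exists o : operand (rook n) K,
    forall f : rook n -> K, read f (results f P) o = groupoid_fourier f rho i j.

Definition fourier_cost Y : nat -> Prop :=
  is_minimum [set l | exists2 P, computes_fourier Y P & size P = l].

Definition rook_complexity : nat -> Prop :=
  is_minimum [set l | exists2 Y, complete_irr_set Y & fourier_cost Y l].

End Complexity.

(* Main.v *)
(* In the groupoid basis the algebra of R_n is, as a vector space, the sum of
   blocks indexed by the pairs (A, B) of subsets of the same size k, each block
   being a copy of the algebra of S_k; so the Fourier transform amounts to C(n,
   k)^2 transforms on S_k for every k. On S_k we use Young's orthogonal form.
   The transform is computed by recursion on k, the k cosets of S_(k-1) being
   combined by the intertwiner Ind V_l -> sum of the V_(l + box). Restricting to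
   S_(k-1) and applying Mackey's formula turns this intertwiner into those of
   the shapes l - box, followed by a scaling and by a Cauchy matrix of size r +
   1, where r is the number of corners of l. Since r(r+1) <= 2(k-1), combining
   the cosets costs O(k^2 dim V_l), which adds up to 3 k^2 k! operations on S_k,
   hence to at most 3 n^2 |R_n| on R_n, and |R_n| >= 2^n gives n = O(log |R_n|).
   Invertibility of the Cauchy matrices shows that the transform is injective,
   so that by counting dimensions the representations used form a complete set. *)
Require Import Defs.
From HB Require Import structures.
From mathcomp Require Import all_boot all_order all_algebra.
From mathcomp Require Import all_classical all_reals all_analysis.
From mathcomp Require Import complex.
From mathcomp Require Import zify ring.
Set Implicit Arguments.
Unset Strict Implicit.
Unset Printing Implicit Defensive.
Import Order.TTheory GRing.Theory Num.Theory.
Local Open Scope ring_scope.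

(** * Young diagrams *)

(* A partition is encoded by its Maya diagram: [true] is a particle, and adding a
   box of content [c] moves a particle from position [p] to the hole [p + 1], with
   [p - c] constant. *)
Section Shapes.
Local Open Scope nat_scope.
Implicit Types (l : seq bool) (p q x y z : nat).

(** No representation theory of S_k is presupposed; everything is read off explicit matrices.
    Operators act on functions of arbitrary lists, and relations are asserted only at lists that are
    tableaux. This is consistent because Young's coefficient from a tableau to a non-tableau is 0.
    Differences of letters are differences of contents, and the last box is the head of the list, so
    that the smaller group acts on the tail. The matrices must be multiplicative on all
    permutations, not just satisfy the Coxeter relations. Lehmer codes provide the words: their
    first digit is a coset, which is also the shape of the fast recursion. In Mackey's formula the
    two double cosets of S_(k-1) in S_k play different roles: the trivial one gives the constant
    column of the Cauchy matrix, the other one the columns 1 / (x - z), for z a corner. The rows are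
    the addable x, one more than the corners. The same two formulas, [fstep_same] and [fstep_diff],
    yield both the operation count and injectivity; bijectivity then supplies matrix units, with
    which any irreducible module is compared directly. *)

Definition adj p q := if q == p then p.+1 else if q == p.+1 then p else q.

Definition sw p l := mkseq (fun q => nth false l (adj p q)) (size l).

Definition addable p l := [&& nth false l p, ~~ nth false l p.+1 & p.+1 < size l].
Definition removable p l := ~~ nth false l p && nth false l p.+1.

Lemma size_sw p l : size (sw p l) = size l.
Proof. by rewrite size_mkseq. Qed.

Lemma nth_true l p : nth false l p -> p < size l.
Proof. by case: (ltnP p (size l)) => // h; rewrite nth_default. Qed.

Lemma removable_size p l : removable p l -> p.+1 < size l.
Proof. by case/andP => _ /nth_true. Qed.

Lemma addable_size p l : addable p l -> p.+1 < size l.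
Proof. by case/and3P. Qed.

Lemma nth_sw p l q : p.+1 < size l -> nth false (sw p l) q = nth false l (adj p q).
Proof.
move=> pl; case: (ltnP q (size l)) => ql; first by rewrite nth_mkseq.
rewrite !nth_default ?size_sw // /adj; case: eqP => ?; first lia.
by case: eqP => // ?; lia.
Qed.

Lemma adjK p : involutive (adj p).
Proof.
move=> q; rewrite /adj; case: (q =P p) => [->|h]; first by rewrite eqxx; case: eqP => //; lia.
by case: (q =P p.+1) => [->|h']; rewrite ?eqxx // (negPf (introN eqP h)) (negPf (introN eqP h')).
Qed.

Lemma swK p l : p.+1 < size l -> sw p (sw p l) = l.
Proof.
move=> pl; apply: (@eq_from_nth _ false); first by rewrite !size_sw.
by move=> q _; rewrite !nth_sw ?size_sw // adjK.
Qed.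

Lemma removable_sw p l : addable p l -> removable p (sw p l).
Proof.
case/and3P => h1 h2 h3; rewrite /removable !nth_sw // /adj eqxx h2 /=.
by case: eqP => //; [lia|rewrite eqxx].
Qed.

Lemma addable_sw p l : removable p l -> addable p (sw p l).
Proof.
move=> h; have h3 := removable_size h; case/andP: h => h1 h2.
rewrite /addable !nth_sw // /adj size_sw eqxx h2 h3 /= eqxx.
by case: eqP => //; [lia|rewrite andbT].
Qed.

Definition far x y := (x.+1 < y) || (y.+1 < x).

Lemma far_sym x y : far x y = far y x.
Proof. by rewrite /far orbC. Qed.

Lemma adj_far x y : far x y -> (adj x y = y) * (adj x y.+1 = y.+1).
Proof.
by rewrite /far /adj => h; split; do 2! [case: eqP => [?|_]; first by move: h; lia].
Qed.

Lemma removable_sw_far x y l : x.+1 < size l -> far x y ->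
  removable y (sw x l) = removable y l.
Proof. by move=> xl h; rewrite /removable !nth_sw // !(adj_far h). Qed.

Lemma addable_sw_far x y l : x.+1 < size l -> far x y ->
  addable y (sw x l) = addable y l.
Proof. by move=> xl h; rewrite /addable !nth_sw // !(adj_far h) size_sw. Qed.

Lemma adjC x y q : far x y -> adj x (adj y q) = adj y (adj x q).
Proof.
rewrite /far /adj => h.
case: (q =P x) => ?; case: (q =P x.+1) => ?; case: (q =P y) => ?;
  case: (q =P y.+1) => ?; repeat (case: eqP => ?); lia.
Qed.

Lemma swC x y l : x.+1 < size l -> y.+1 < size l -> far x y ->
  sw x (sw y l) = sw y (sw x l).
Proof.
move=> xl yl h; apply: (@eq_from_nth _ false); first by rewrite !size_sw.
by move=> q _; rewrite !nth_sw ?size_sw //; rewrite -adjC.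
Qed.

Lemma removable_far x y l : removable x l -> removable y l -> x != y -> far x y.
Proof.
rewrite /removable /far => /andP[h1 h2] /andP[h3 h4] xy.
have n1 : y != x.+1 by apply/eqP => e; move: h3; rewrite e h2.
have n2 : x != y.+1 by apply/eqP => e; move: h1; rewrite e h4.
lia.
Qed.

Lemma addable_far x y l : addable x l -> addable y l -> x != y -> far x y.
Proof.
rewrite /addable /far => /and3P[h1 h2 _] /and3P[h3 h4 _] xy.
have n1 : y != x.+1 by apply/eqP => e; move: h2; rewrite -e h3.
have n2 : x != y.+1 by apply/eqP => e; move: h4; rewrite -e h1.
lia.
Qed.

Lemma removable_sw_neq x y l : removable x l -> removable y (sw x l) -> x != y.
Proof.
move=> hx hy; have xl := removable_size hx; have [h1 h2] := andP hx.
apply/eqP => e; move: hy; rewrite -e => /andP[].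
by rewrite nth_sw // /adj eqxx h2.
Qed.

(** Between two boxes of one diagonal a tableau must receive boxes on both neighbouring diagonals,
    so a single intermediate step is not enough. The braid relation divides by [x - z]. *)
Lemma removable3 x y z l : removable x l -> removable y (sw x l) ->
  removable z (sw y (sw x l)) -> x != z.
Proof.
move=> hx hy hz; have xl := removable_size hx; have yl := removable_size hy.
have xy := removable_sw_neq hx hy.
apply/eqP => e; subst z; have /and3P[a1 a2 _] := addable_sw hx.
case/andP: hz; rewrite size_sw in yl; rewrite !(nth_sw (l := sw x l)) ?size_sw //.
rewrite /adj (negPf xy); case: (x =P y.+1) => [e|_]; last by rewrite a1.
by rewrite !ifN ?(negPf a2) //; lia.
Qed.

Definition adds l := [seq p <- iota 0 (size l) | addable p l].
Definition rems l := [seq p <- iota 0 (size l) | removable p l].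

Lemma mem_adds p l : (p \in adds l) = addable p l.
Proof.
rewrite mem_filter mem_iota /=; case h: addable => //=.
by move/addable_size: h; lia.
Qed.

Lemma mem_rems p l : (p \in rems l) = removable p l.
Proof.
rewrite mem_filter mem_iota /=; case h: removable => //=.
by move/removable_size: h; lia.
Qed.

Lemma uniq_adds l : uniq (adds l).
Proof. by rewrite filter_uniq ?iota_uniq. Qed.

Lemma uniq_rems l : uniq (rems l).
Proof. by rewrite filter_uniq ?iota_uniq. Qed.

Lemma perm_rems_sw x l : addable x l ->
  perm_eq (rems (sw x l)) (x :: [seq y <- rems l | far x y]).
Proof.
move=> hx; have xl := addable_size hx; apply: uniq_perm; rewrite ?uniq_rems //=.
  by rewrite filter_uniq ?uniq_rems // andbT mem_filter /far; lia.
move=> y; rewrite in_cons mem_rems mem_filter mem_rems.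
case: (eqVneq y x) => [->|ne] /=; first by rewrite removable_sw.
case: (boolP (far x y)) => /= f; first exact: removable_sw_far.
apply/negP => h; move/negP: f; apply.
by apply: removable_far (removable_sw hx) h _; rewrite eq_sym.
Qed.

Lemma perm_adds_sw y l : removable y l ->
  perm_eq (adds (sw y l)) (y :: [seq x <- adds l | far x y]).
Proof.
move=> hy; have yl := removable_size hy; apply: uniq_perm; rewrite ?uniq_adds //=.
  by rewrite filter_uniq ?uniq_adds // andbT mem_filter /far; lia.
move=> x; rewrite in_cons mem_adds mem_filter mem_adds.
case: (eqVneq x y) => [->|ne] /=; first by rewrite addable_sw.
case: (boolP (far x y)) => /= f; first by rewrite addable_sw_far // far_sym.
apply/negP => h; move/negP: f; apply.
exact: addable_far h (addable_sw hy) ne.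
Qed.

(* The pairs (hole, particle) with the hole on the left are the boxes of the
   partition. *)
Fixpoint inv l :=
  if l is b :: l' then (if b then 0 else count id l') + inv l' else 0.

Lemma sw0 a b l : sw 0 (a :: b :: l) = b :: a :: l.
Proof.
apply: (@eq_from_nth _ false); first by rewrite size_sw.
by move=> [|[|q]] _; rewrite nth_sw.
Qed.

Lemma swS p b l : p.+1 < size l -> sw p.+1 (b :: l) = b :: sw p l.
Proof.
move=> pl; have aS q : adj p.+1 q.+1 = (adj p q).+1.
  by rewrite /adj !eqSS; case: eqP => // _; case: eqP.
apply: (@eq_from_nth _ false); first by rewrite size_sw /= size_sw.
by case=> [|q] _; rewrite nth_sw // aS /= nth_sw.
Qed.

Lemma count_sw p l : p.+1 < size l -> count id (sw p l) = count id l.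
Proof.
elim: p l => [|p IH] [|a [|b l]] // h; first by rewrite sw0 /=; lia.
rewrite swS //; have e := IH (b :: l) h.
by change (a + count id (sw p (b :: l)) = a + count id (b :: l)); rewrite e.
Qed.

Lemma inv_sw p l : removable p l -> inv l = (inv (sw p l)).+1.
Proof.
move=> h; have := removable_size h; elim: p l h => [|p IH] [|a [|b l]] // h _.
  by rewrite sw0; case: a b h => [] [] //= _; lia.
have h' : removable p (b :: l) by move: h; rewrite /removable.
have hs := removable_size h'.
rewrite swS //; have e := IH _ h' hs; have e' := count_sw hs.
change ((if a then 0 else count id (b :: l)) + inv (b :: l) =
  ((if a then 0 else count id (sw p (b :: l))) + inv (sw p (b :: l))).+1).
by rewrite e e' addnS.
Qed.

Lemma size_rems_cons b l :
  size (rems (b :: l)) = (~~ b && nth false l 0) + size (rems l).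
Proof.
rewrite /rems !size_filter /= -[1]addn0 iotaDl count_map.
by congr (_ + _); apply: eq_count => p.
Qed.

Lemma size_adds_cons b c l :
  size (adds [:: b, c & l]) = (b && ~~ c) + size (adds (c :: l)).
Proof.
rewrite /adds !size_filter.
have -> : iota 0 (size [:: b, c & l]) = 0 :: map (addn 1) (iota 0 (size (c :: l))).
  by rewrite -iotaDl.
rewrite [LHS]/= count_map; by congr (_ + _); rewrite /addable /= andbT.
Qed.

(** Rises and falls of a 0-1 word alternate, so their numbers differ only through the two end
    letters. *)
Lemma size_adds_rems b l :
  size (adds (b :: l)) + last b l = size (rems (b :: l)) + b.
Proof.
elim: l b => [|c l IH] b; first by rewrite /adds /rems /addable /removable /= !andbF.
rewrite size_adds_cons (size_rems_cons b) [nth _ _ _]/= [last b _]/=.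
by case: b; case: c (IH c) => /=; lia.
Qed.

Lemma rems_count l : size (rems l) + nth false l 0 <= count id l.
Proof.
elim: l => [|b l IH] //; rewrite size_rems_cons [nth _ _ _]/= [count _ _]/=.
by case: b; case: (nth false l 0) IH => /=; lia.
Qed.

(** A partition with r corners contains the staircase r, r-1, ..., 1. In the induction, a hole put
    before a particle creates one corner and, by [rems_count], at least as many boxes as there are
    corners now. *)
Lemma rems_inv l : size (rems l) * (size (rems l)).+1 <= 2 * inv l.
Proof.
elim: l => [|b l IH] //; rewrite size_rems_cons [inv _]/=.
have := rems_count l.
by case: b; case: (nth false l 0) => /=; nia.
Qed.

End Shapes.

(** * Standard tableaux *)

Section Paths.
Local Open Scope nat_scope.
Variable n : nat.
Implicit Types (l : seq bool) (p x y k : nat) (w : seq nat).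

Definition l0 : seq bool := nseq n true ++ nseq n false.

Definition good k l := [/\ size l = n + n, count id l = n & inv l = k].

Lemma good_l0 : good 0 l0.
Proof.
have c m : count id (nseq m false) = 0 by elim: m.
split; first by rewrite size_cat !size_nseq.
  by rewrite /l0 count_cat c addn0 count_nseq mul1n.
have i0 m : inv (nseq m false) = 0 by elim: m => //= m; rewrite c.
by rewrite /l0; elim: {1}n => [|m IH] //=.
Qed.

Lemma good_removable k p l : removable p l -> good k.+1 l <-> good k (sw p l).
Proof.
move=> h; have hs := removable_size h.
rewrite /good size_sw count_sw // (inv_sw h).
by split=> -[-> -> e]; split=> //; [case: e | rewrite e].
Qed.

Lemma inv_head l : ~~ nth false l 0 -> count id l <= inv l.
Proof. by case: l => [|[] l] //= _; rewrite add0n leq_addr. Qed.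

Lemma inv_last b l : last b l -> count negb (b :: l) <= inv (b :: l).
Proof.
elim: l b => [|c l IH] [] //= h; first by rewrite !add0n; exact: IH h.
have := IH c h => /=; case: c h => /= h; first lia.
have : has id l by move: h; clear; elim: l => [|[] l IH].
by rewrite has_count => ?; move=> ?; lia.
Qed.

(** With fewer than n boxes the frame is not felt: a hole at the head lies left of all n particles,
    a particle at the end lies right of all n holes, and either forces n boxes. *)
Lemma good_adds k l : good k l -> k < n -> size (adds l) = (size (rems l)).+1.
Proof.
case: l => [|b l]; first by case=> /= ? _ _; lia.
move=> [h1 h2 h3] kn; have := size_adds_rems b l.
have b1 : b by apply/negPn/negP => nb; have := @inv_head (b :: l) nb; lia.
have -> : last b l = false; last by rewrite b1; lia.
apply/negP => h; have := inv_last h; have := count_predC id (b :: l).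
by rewrite (eq_count (a1 := predC id) (a2 := negb)) //; lia.
Qed.

(* The standard tableaux of shape [l], as lists of the positions of their boxes,
   the last box added first. *)
Fixpoint paths k l : seq (seq nat) :=
  if k is k'.+1 then flatten [seq [seq p :: w | w <- paths k' (sw p l)] | p <- rems l]
  else if l == l0 then [:: [::]] else [::].

Lemma pathsE k l : paths k.+1 l =
  flatten [seq [seq p :: w | w <- paths k (sw p l)] | p <- rems l].
Proof. by []. Qed.

Lemma paths_nil k l : ([::] \in paths k l) -> k = 0.
Proof.
case: k => // k /flatten_mapP[p _ /mapP[w _]] //.
Qed.

Lemma paths_cons k l p w : (p :: w \in paths k l) =
  [&& 0 < k, removable p l & w \in paths k.-1 (sw p l)].
Proof.
case: k => [|k] /=; first by case: eqP.
apply/flatten_mapP/andP => [[q]|[h1 h2]].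
  by rewrite mem_rems => hq /mapP[v hv [-> ->]].
by exists p; rewrite ?mem_rems //; apply: map_f.
Qed.

Lemma paths0 w l : (w \in paths 0 l) = (w == [::]) && (l == l0).
Proof. by rewrite /=; case: eqP; rewrite ?inE ?andbT ?andbF. Qed.

Lemma pathsS k l w : w \in paths k.+1 l ->
  exists p v, [/\ w = p :: v, removable p l & v \in paths k (sw p l)].
Proof.
case: w => [/paths_nil|p v] //; rewrite paths_cons => /and3P[_ h1 h2].
by exists p, v.
Qed.

Lemma uniq_paths k l : uniq (paths k l).
Proof.
elim: k l => [|k IH] l /=; first by case: eqP.
have := uniq_rems l; elim: (rems l) => //= p s IHs /andP[ps us].
rewrite cat_uniq map_inj_uniq ?IH ?IHs //; last by move=> ? ? [].
rewrite andbT /=; apply/hasPn => w /flatten_mapP[q qs /mapP[v _ ->]].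
by apply/negP => /mapP[u _ [e _]]; rewrite -e qs in ps.
Qed.

Lemma paths_good k l w : w \in paths k l -> good k l.
Proof.
elim: k l w => [|k IH] l w.
  by rewrite paths0 => /andP[_ /eqP ->]; exact: good_l0.
by case/pathsS=> p [v [_ h /IH g]]; apply/(good_removable _ h).
Qed.

Lemma size_pathsS k l : size (paths k.+1 l) = \sum_(p <- rems l) size (paths k (sw p l)).
Proof.
rewrite /= size_flatten /shape -map_comp sumnE big_map; apply: eq_bigr => p _.
by rewrite /= size_map.
Qed.

#[global] Arguments paths k l : simpl never.

(** Adding then removing a box differs from removing then adding by the identity: moves at far
    positions commute, and the moves that undo each other number [size (adds l)] in one order and
    [size (rems l)], one fewer, in the other. *)
Lemma sum_paths_adds k l : good k l -> k < n ->
  \sum_(x <- adds l) size (paths k.+1 (sw x l)) = k.+1 * size (paths k l).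
Proof.
elim: k l => [|k IH] l gl kn.
  have r0 : rems l = [::].
    have [_ _ i0] := gl; apply/nilP; rewrite /nilp.
    by have := rems_inv l; rewrite i0; case: (size _).
  have: size (adds l) = 1 by rewrite (good_adds gl) // r0.
  move: (mem_adds ^~ l); case: (adds l) => [|x [|]] // /(_ x) ax _.
  rewrite big_seq1 size_pathsS mul1n.
  have {}ax : addable x l by rewrite -ax mem_head.
  rewrite (perm_big _ (perm_rems_sw ax)) r0 /= big_cons big_nil swK ?addn0 //.
  exact: addable_size ax.
have e1 : \sum_(x <- adds l) size (paths k.+2 (sw x l)) =
   size (adds l) * size (paths k.+1 l) +
   \sum_(x <- adds l) \sum_(y <- rems l | far x y) size (paths k.+1 (sw y (sw x l))).
  rewrite -sum1_size big_distrl -big_split /=; apply: eq_big_seq => x.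
  rewrite mem_adds => ax; rewrite (size_pathsS k.+1) (perm_big _ (perm_rems_sw ax)).
  by rewrite big_cons big_filter swK ?mul1n //; exact: addable_size ax.
have e2 : \sum_(x <- adds l) \sum_(y <- rems l | far x y) size (paths k.+1 (sw y (sw x l)))
     + size (rems l) * size (paths k.+1 l) = k.+1 * size (paths k.+1 l).
  rewrite (exchange_big_dep xpredT) //= [in RHS]size_pathsS big_distrr /=.
  rewrite -sum1_size big_distrl -big_split /=; apply: eq_big_seq => y.
  rewrite mem_rems => ry; rewrite -IH; last 2 first.
  - exact/(good_removable _ ry).
  - exact: ltnW.
  have ys := removable_size ry.
  rewrite (perm_big _ (perm_adds_sw ry)) big_cons big_filter mul1n swK // addnC.
  rewrite /=; congr (_ + _); rewrite big_seq_cond [RHS]big_seq_cond; apply: eq_bigr => x.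
  rewrite mem_adds => /andP[ax f].
  by rewrite (@swC x y) // (addable_size ax).
by rewrite e1 (good_adds gl kn) !mulSn; move: e2; lia.
Qed.

Fixpoint endpt w : seq bool := if w is p :: w' then sw p (endpt w') else l0.

Fixpoint allpaths k : seq (seq nat) :=
  if k is k'.+1 then flatten [seq [seq p :: w | p <- adds (endpt w)] | w <- allpaths k']
  else [:: [::]].

Lemma paths_allpaths k l w : (w \in paths k l) = (w \in allpaths k) && (endpt w == l).
Proof.
elim: k l w => [|k IH] l w.
  by rewrite paths0 inE; case: eqP => //= ->; rewrite eq_sym.
case: w => [|p w]; last first.
  rewrite paths_cons /= IH; apply/and3P/andP => [[h1 h2 /eqP e]|[]].
    have e' : sw p (endpt w) = l by rewrite e swK //; apply: removable_size h1.
    rewrite e' eqxx; split=> //; apply/flatten_mapP; exists w => //.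
    by apply: map_f; rewrite mem_adds e addable_sw.
  case/flatten_mapP => v hv /mapP[q]; rewrite mem_adds => hq [-> ->] /eqP <-.
  by rewrite removable_sw // swK ?hv //; apply: addable_size hq.
apply/idP/idP => [/paths_nil //|/andP[/flatten_mapP[v _ /mapP[q]]]] //.
Qed.

(** This is the sum of the squared degrees of S_k: every shape occurs once for each of its tableaux,
    so partitions need not be enumerated. *)
Lemma sum_allpaths k : k <= n -> \sum_(w <- allpaths k) size (paths k (endpt w)) = k`!.
Proof.
elim: k => [|k IH] kn; first by rewrite big_seq1 /paths /= eqxx.
rewrite /= big_flatten big_map factS -IH 1?ltnW // big_distrr /=.
apply: eq_big_seq => w hw; rewrite big_map /= -sum_paths_adds //.
by apply: (@paths_good k _ w); rewrite paths_allpaths hw eqxx.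
Qed.

End Paths.

Arguments paths n k l : simpl never.

(** * Young's orthogonal form *)

Section Operators.
Variables (K : numClosedFieldType) (n : nat).
Implicit Types (l : seq bool) (i k m p q x y z : nat) (w v c u : seq nat).
Implicit Types (F G : seq nat -> K).

Definition invdiff x y : K := (x%:R - y%:R)^-1.
Definition offdiag x y : K := sqrtC (1 - invdiff x y ^+ 2).

Lemma invdiffN x y : invdiff y x = - invdiff x y.
Proof. by rewrite /invdiff -invrN opprB. Qed.

Lemma offdiag_sym x y : offdiag y x = offdiag x y.
Proof. by rewrite /offdiag invdiffN sqrrN. Qed.

Lemma offdiag_sq x y : offdiag x y * offdiag x y = 1 - invdiff x y ^+ 2.
Proof. by rewrite -expr2 sqrtCK. Qed.

Lemma diff_neq0 x y : x != y -> x%:R - y%:R != 0 :> K.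
Proof. by rewrite subr_eq0 eqr_nat. Qed.

Lemma offdiag_eq0 x y : x != y -> (offdiag x y == 0) = ~~ far x y.
Proof.
move=> xy; rewrite /offdiag sqrtC_eq0 subr_eq0 eq_sym /invdiff exprVn invr_eq1.
rewrite sqrf_eq1 -eqr_oppLR opprB !subr_eq !nat1r !eqr_nat /far; lia.
Qed.

Lemma path2 k l x y w : x :: y :: w \in paths n k l ->
  [/\ x != y, far x y -> y :: x :: w \in paths n k l &
      ~~ far x y -> offdiag x y = 0].
Proof.
rewrite !paths_cons => /and3P[k0 hx /and3P[k1 hy hw]].
have xy := removable_sw_neq hx hy; have xl := removable_size hx.
split=> // f; last by apply/eqP; rewrite offdiag_eq0.
have hy' : removable y l by rewrite -(removable_sw_far xl f).
have yl := removable_size hy'.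
have f' : far y x by rewrite far_sym.
by rewrite k0 k1 hy' (removable_sw_far yl f') hx (swC xl yl f).
Qed.

(* The adjacent transposition of the last two boxes, in Young's orthogonal form.
   Its off-diagonal coefficient vanishes when the exchanged list is no tableau. *)
Definition tau F w :=
  if w is x :: y :: w' then invdiff x y * F w + offdiag x y * F [:: y, x & w']
  else F w.

(** Shifts generators by one place: [under tau] is the adjacent transposition next to [tau]. *)
Definition under (A : (seq nat -> K) -> seq nat -> K) F w :=
  if w is x :: w' then A (fun v => F (x :: v)) w' else F w.

(* Only paths of length at least [m] are compared: the braid relation involves
   three consecutive letters. *)
Definition eqop m (A B : (seq nat -> K) -> seq nat -> K) :=
  forall k l w F, (m <= k)%N -> w \in paths n k l -> A F w = B F w.

(** Locality lets functions on all lists stand for vectors of the module of one shape, without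
    building a space for each shape. *)
Definition local (A : (seq nat -> K) -> seq nat -> K) := forall k l F G,
  {in paths n k l, F =1 G} -> {in paths n k l, A F =1 A G}.

Definition linop (A : (seq nat -> K) -> seq nat -> K) := forall a F G w,
  A (fun v => a * F v + G v) w = a * A F w + A G w.

Lemma tau_local : local tau.
Proof.
move=> k l F G FG [|x [|y w]] hw; rewrite /tau (FG _ hw) //; congr (_ + _).
have [_ f nf] := path2 hw.
by case: (boolP (far x y)) => h; [rewrite (FG _ (f h)) | rewrite (nf h) !mul0r].
Qed.

Lemma under_local A : local A -> local (under A).
Proof.
move=> hA k l F G FG [|x w] hw; rewrite /under ?FG //.
move: hw; rewrite paths_cons => /and3P[k0 hx hw]; apply: hA hw => v hv.
by rewrite FG // paths_cons k0 hx.
Qed.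

Lemma tau_lin : linop tau.
Proof. by move=> a F G [|x [|y w]] //=; ring. Qed.

Lemma under_lin A : linop A -> linop (under A).
Proof. by move=> hA a F G [|x w] //=. Qed.

Lemma eqop_under m A B : eqop m A B -> eqop m.+1 (under A) (under B).
Proof.
move=> AB k l [|x w] F // mk; rewrite paths_cons => /and3P[k0 hx hw] /=.
by apply: AB hw; lia.
Qed.

Lemma under_comp A B F : under (fun G => A (B G)) F = under A (under B F).
Proof. by apply/funext => -[|x w]. Qed.

Lemma tauK : eqop 0 (fun F => tau (tau F)) id.
Proof.
move=> k l [|x [|y w]] F // _ _ /=.
rewrite (offdiag_sym x y) (invdiffN x y).
have := offdiag_sq x y; move: (offdiag x y) (invdiff x y) => b a e.
have -> : a * (a * F [:: x, y & w] + b * F [:: y, x & w]) +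
  b * (- a * F [:: y, x & w] + b * F [:: x, y & w]) =
  (a ^+ 2 + b * b) * F [:: x, y & w] by ring.
by rewrite e addrC subrK mul1r.
Qed.

Lemma lin0 A w : linop A -> A (fun=> 0) w = 0.
Proof.
move=> lA; have := lA (-1) (fun=> 0) (fun=> 0) w.
by rewrite !mulN1r !addNr.
Qed.

Lemma linZ A a F w : linop A -> A (fun v => a * F v) w = a * A F w.
Proof.
move=> lA; have := lA a F (fun=> 0) w; rewrite (lin0 _ lA) addr0 => <-.
by congr (A _ w); apply/funext => v; rewrite addr0.
Qed.

Lemma lin_sum A (I : Type) (s : seq I) (G : I -> seq nat -> K) w : linop A ->
  A (fun v => \sum_(j <- s) G j v) w = \sum_(j <- s) A (G j) w.
Proof.
move=> lA; elim: s => [|j s IH].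
  by rewrite big_nil -[RHS](lin0 w lA); congr (A _ w); apply/funext => v; rewrite big_nil.
rewrite big_cons -IH -[A (G j) w]mul1r -lA.
by congr (A _ w); apply/funext => v; rewrite big_cons mul1r.
Qed.

Lemma tau_under2 A F : linop A -> tau (under (under A) F) = under (under A) (tau F).
Proof.
move=> lA; apply/funext => -[|x [|y w]] //=.
by rewrite lA; congr (_ + _); rewrite -linZ.
Qed.

Lemma braid : eqop 3 (fun F => tau (under tau (tau F)))
                     (fun F => under tau (tau (under tau F))).
Proof.
move=> k l w F k3 hw.
have: size w = k by elim: (k) l w hw {k3} => [|k' IH] l w;
  [rewrite paths0 => /andP[/eqP ->] | case/pathsS => p [v [-> _ /IH /= ->]]].
case: w hw => [|x [|y [|z w]]] hw sw; rewrite /= in sw; try lia.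
move: (hw); rewrite !paths_cons => /and3P[_ hx /and3P[_ hy /and3P[_ hz _]]].
have xz := removable3 hx hy hz.
have xy := removable_sw_neq hx hy; have yz := removable_sw_neq hy hz.
rewrite /= ?(offdiag_sym x y) ?(offdiag_sym x z) ?(offdiag_sym y z).
have := offdiag_sq x y; have := offdiag_sq y z; have := offdiag_sq x z.
move: (offdiag x y) (offdiag y z) (offdiag x z) => b d f.
rewrite ?(invdiffN x y) ?(invdiffN x z) ?(invdiffN y z).
(* Partial fractions of 1 / ((x - y)(y - z)). This relation and the equations for the squares of the
   off-diagonal entries at (x, y) and (y, z) generate the difference of the two sides. *)
have : invdiff x y * invdiff y z = invdiff x z * (invdiff x y + invdiff y z).
  have := diff_neq0 xy; have := diff_neq0 xz; have := diff_neq0 yz.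
  rewrite /invdiff => h1 h2 h3; field.
  by rewrite h1 h2 h3.
move: (invdiff x y) (invdiff y z) (invdiff x z) => a c e h hf hd hb.
move: (F [:: x, y, z & w]) (F [:: x, z, y & w]) (F [:: y, x, z & w])
  (F [:: y, z, x & w]) (F [:: z, x, y & w]) (F [:: z, y, x & w]) => f1 f2 f3 f4 f5 f6.
apply/eqP; rewrite -subr_eq0; set r := _ - _.
have -> : r = (a * c - e * (a + c)) * ((a - c) * f1 - d * f2 + b * f3) +
  e * f1 * ((b * b - (1 - a ^+ 2)) - (d * d - (1 - c ^+ 2))) by rewrite /r; ring.
by rewrite h hb hd !subrr mul0r mulr0 addr0.
Qed.

(* [cyc i] represents the cycle sending 0 to [i], and [repr c] the permutation
   with Lehmer code [c]; letter 0 acts on the head of a path. *)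
Fixpoint cyc i F : seq nat -> K :=
  if i is i'.+1 then under (cyc i') (tau F) else F.

Fixpoint repr c F : seq nat -> K :=
  if c is i :: c' then cyc i (under (repr c') F) else F.

Fixpoint lehmer u : seq nat :=
  if u is x :: u' then count (fun y => (y < x)%N) u' :: lehmer u' else [::].

Lemma cyc_lin i : linop (cyc i).
Proof.
elim: i => [|i IH] a F G w //=; rewrite -under_lin //; congr (under _ _ w).
by apply/funext => v; rewrite tau_lin.
Qed.

Lemma cyc_local i : local (cyc i).
Proof.
elim: i => [|i IH] k l F G FG //=; apply: under_local => //.
exact: tau_local.
Qed.

Lemma repr_lin c : linop (repr c).
Proof.
elim: c => [|i c IH] a F G w //=; rewrite -cyc_lin //; congr (cyc _ _ w).
by apply/funext => v; rewrite under_lin.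
Qed.

Lemma repr_local c : local (repr c).
Proof.
elim: c => [|i c IH] k l F G FG //=; apply: cyc_local.
exact: under_local.
Qed.

Lemma cycS i F : cyc i.+1 F = under (cyc i) (tau F).
Proof. by []. Qed.

(** Two insertion cycles are exchanged at the price of a shift: one braid relation at the head, then
    the induction hypothesis on the tail. *)
Lemma cyc_cyc p q : (p <= q)%N ->
  eqop q.+2 (fun F => cyc p (cyc q.+1 F)) (fun F => cyc q.+1 (under (cyc p) F)).
Proof.
elim: p q => [|p IH] q pq k l w F qk hw.
  by congr (cyc _ _ w); apply/funext => -[].
case: q pq qk => // q pq qk.
have lp := @cyc_lin p; have lq := @cyc_lin q.
have e1 : cyc q.+2 F = under (under (cyc q)) (under tau (tau F)) by rewrite -under_comp.
rewrite e1 cycS tau_under2 //.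
have step1 : under (cyc p) (under (under (cyc q)) (tau (under tau (tau F)))) w =
             under (cyc p) (under (under (cyc q)) (under tau (tau (under tau F)))) w.
  apply: (under_local (@cyc_local p)) hw => v hv.
  by apply: (under_local (under_local (@cyc_local q))) hv => u; apply: braid; lia.
have e2 : under (cyc p) (under (under (cyc q)) (under tau (tau (under tau F)))) =
          under (fun H => cyc p (cyc q.+1 H)) (tau (under tau F)).
  by rewrite (under_comp (cyc p) (cyc q.+1)) -(under_comp (under (cyc q)) tau).
rewrite step1 e2 (eqop_under (IH q pq) _ qk hw) under_comp -tau_under2 //.
by rewrite -under_comp.
Qed.

(** The cycle pulls [v] to the front, so the right side is the operator of the word [v :: b1 ++ b2].
    Passing a letter [x] exchanges two cycles by [cyc_cyc]; if [v < x] an inversion disappears, and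
    [tauK] cancels the two transpositions. *)
Lemma repr_cyc (b1 b2 : seq nat) (v : nat) : v \notin b1 ->
  eqop (size (b1 ++ v :: b2))
    (fun F => repr (lehmer (b1 ++ v :: b2)) (cyc (size b1) F))
    (fun F => cyc (count (fun y => (y < v)%N) (b1 ++ b2))
                (under (repr (lehmer (b1 ++ b2))) F)).
Proof.
elim: b1 => [|x b1 IH] //; rewrite inE negb_or => /andP[vx vb] k l w F sk hw.
rewrite [size (x :: b1)]/= cycS /= -under_comp.
set A1 := repr (lehmer (b1 ++ b2)); set q := count (fun y => (y < v)%N) (b1 ++ b2).
set q' := count (fun y => (y < x)%N) (b1 ++ b2).
have e1 : cyc (count (fun y => (y < x)%N) (b1 ++ v :: b2))
      (under (fun G => repr (lehmer (b1 ++ v :: b2)) (cyc (size b1) G)) (tau F)) w =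
    cyc (count (fun y => (y < x)%N) (b1 ++ v :: b2))
      (under (fun G => cyc q (under A1 G)) (tau F)) w.
  by apply: (@cyc_local _) hw => u hu; apply: (eqop_under (IH vb) _ sk hu).
rewrite {}e1 [in LHS]under_comp -tau_under2; last exact: repr_lin.
rewrite -cycS [in RHS]under_comp -/A1 -/q'.
set G := under (under A1) F.
have -> : count (fun y => (y < x)%N) (b1 ++ v :: b2) = (q' + (v < x))%N.
  by rewrite /q' !count_cat /=; lia.
have sq : (q <= size (b1 ++ b2))%N by apply: count_size.
have sq' : (q' <= size (b1 ++ b2))%N by apply: count_size.
have sk' : (size (b1 ++ b2) < k.-1)%N by move: sk; rewrite /= !size_cat /=; lia.
case: (ltngtP v x) vx => // h _; rewrite ?addn1 ?addn0 ?add0n ?add1n.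
  have qq : (q <= q')%N by rewrite /q /q'; apply: sub_count => y /=; lia.
  have st u H : u \in paths n k l -> cyc q (cyc q'.+1 H) u = cyc q'.+1 (under (cyc q) H) u.
    have mk : (q'.+2 <= k)%N by lia.
    by move=> hu; exact: (cyc_cyc qq H mk hu).
  rewrite [cyc q.+1 G]cycS -st //=.
  apply: (@cyc_local _) hw => u hu; apply: (under_local (@cyc_local _)) hu => u' hu'.
  by rewrite (tauK _ _ hu').
have qq : (q' <= q)%N by rewrite /q /q'; apply: sub_count => y /=; lia.
have mk : (q.+2 <= k)%N by lia.
exact: (cyc_cyc qq G mk hw).
Qed.

(* Multiplicativity of [repr], for permutations written as words in arbitrary
   distinct letters: [lehmer] only sees the relative order of the letters. *)
Lemma repr_comp s u (h : nat -> nat) : sorted ltn s -> perm_eq s u ->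
  {in u &, injective h} ->
  eqop (size u) (repr (lehmer (map h u)))
    (fun F => repr (lehmer (map h s)) (repr (lehmer u) F)).
Proof.
elim: u s => [|x u IH] s; first by move=> _ /perm_nilP ->.
move=> ss su hi k l w F sk hw; have xs : x \in s by rewrite (perm_mem su) mem_head.
case/splitPr: xs ss su => b1 b2 ss su.
have su' : perm_eq (b1 ++ b2) u.
  rewrite -(perm_cons x); apply: perm_trans su.
  by rewrite -cat1s -(cat1s x b2) perm_catCA.
have hi' : {in u &, injective h}.
  by move=> a b au bu; apply: hi; rewrite inE ?au ?bu orbT.
have := ss; rewrite (sorted_pairwise ltn_trans) pairwise_cat /= allrel_consr.
case/and3P => /andP[a1 a2] pw1 /andP[a3 pw2].
have ss' : sorted ltn (b1 ++ b2).
  by rewrite (sorted_pairwise ltn_trans) pairwise_cat a2 pw1 pw2.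
have c1 : count (fun y => (y < x)%N) u = size b1.
  rewrite -(permP su') count_cat; have -> : count (fun y => (y < x)%N) b2 = 0%N.
    by apply/eqP; rewrite -leqn0 leqNgt -has_count; apply/hasPn => y /(allP a3) /ltnW; rewrite -leqNgt.
  by rewrite addn0; apply/eqP; rewrite -all_count; apply: sub_all a1.
have c2 : count (fun y => (y < h x)%N) (map h u) =
          count (fun y => (y < h x)%N) (map h b1 ++ map h b2).
  by rewrite -map_cat; apply/esym/permP/perm_map.
have nb : h x \notin map h b1.
  apply/mapP => -[y yb e].
  have yu : y \in u by rewrite -(perm_mem su') mem_cat yb.
  have exy : x = y by apply: hi e; rewrite ?mem_head // inE yu orbT.
  by have := allP a1 _ yb; rewrite -exy /= ltnn.
have mk : (size (map h b1 ++ h x :: map h b2) <= k)%N.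
  by apply: leq_trans sk; rewrite -(perm_size su) !size_cat /= !size_map.
rewrite map_cat /= c1 -(size_map h b1) (repr_cyc nb _ mk hw).
rewrite c2 -map_cat -under_comp.
apply: (@cyc_local _) hw => v hv; by apply: (eqop_under (IH _ ss' su' hi') _ sk hv).
Qed.

End Operators.

(** * The Fourier transform on the symmetric groups *)

Section Fourier.
Variables (K : numClosedFieldType) (n : nat).
Implicit Types (l : seq bool) (i k m x y z : nat) (w v c u P Q R : seq nat).
Implicit Types (F G : seq nat -> K).
Local Notation invdiff := (invdiff K).
Local Notation offdiag := (offdiag K).

Definition delta Q v : K := (v == Q)%:R.

(** When [G] is a column of a second operator, this is the matrix product over the tableaux of one
    shape. *)
Lemma local_expand A G k l P : linop A -> local n A -> P \in paths n k l ->
  A G P = \sum_(R <- paths n k l) A (delta R) P * G R.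
Proof.
move=> lA cA hP; under eq_bigr do rewrite mulrC -linZ //.
rewrite -lin_sum //; apply: (cA k l) => // v hv.
rewrite (bigD1_seq v) ?uniq_paths //= /delta eqxx mulr1 big1 ?addr0 // => R.
by rewrite eq_sym => /negPf ->; rewrite mulr0.
Qed.

Fixpoint codes k : seq (seq nat) :=
  if k is k'.+1 then flatten [seq [seq i :: c | c <- codes k'] | i <- iota 0 k]
  else [:: [::]].

Lemma codes_cons k i c : (i :: c \in codes k.+1) = (i <= k)%N && (c \in codes k).
Proof.
apply/flatten_mapP/andP => [[j]|[h1 h2]].
  by rewrite mem_iota => hj /mapP[v hv [-> ->]].
by exists i; rewrite ?mem_iota //; apply: map_f.
Qed.

Lemma codesS k c : c \in codes k.+1 -> exists i c', c = i :: c'.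
Proof. by case/flatten_mapP => i _ /mapP[c' _ ->]; exists i, c'. Qed.

Lemma lehmer_codes u : lehmer u \in codes (size u).
Proof.
by elim: u => [|x u IH] //; rewrite [size _]/= [lehmer _]/= codes_cons IH count_size.
Qed.

Definition fourier k (phi : seq nat -> K) P Q :=
  \sum_(c <- codes k) phi c * repr c (delta Q) P.

Definition tens x (X : seq nat -> K) v : K :=
  if v is y :: v' then (y == x)%:R * X v' else 0.

(* [X i] is a vector in the coset [i] of an induced module, [x] the letter by
   which the shape of the inducing module is extended. *)
Definition fstep k (X : nat -> seq nat -> K) x P :=
  \sum_(i <- iota 0 k.+1) cyc i (tens x (X i)) P.

(** The first digit of a Lehmer code names the coset, the others the element of the smaller
    group. *)
Lemma fourierS k phi P x Q : fourier k.+1 phi P (x :: Q) =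
  fstep k (fun i v => fourier k (fun c => phi (i :: c)) v Q) x P.
Proof.
rewrite /fourier big_flatten big_map; apply: eq_bigr => i _; rewrite big_map.
under eq_bigr do rewrite [repr _ _ _]/= -(linZ _ _ _ (@cyc_lin _ i)).
rewrite -(lin_sum _ _ _ (@cyc_lin _ i)); congr (cyc i _ P).
apply/funext => -[|y v] /=.
  by rewrite big1 // => c _; rewrite /delta mulr0.
rewrite big_distrr; apply: eq_bigr => c _ /=.
rewrite mulrCA; congr (_ * _); rewrite -(linZ _ _ _ (@repr_lin _ c)).
congr (repr c _ v); apply/funext => u; rewrite /delta eqseq_cons.
by case: (y == x); rewrite ?mul1r ?mul0r.
Qed.

Lemma fstep0 X x y R : fstep 0 X x (y :: R) = (y == x)%:R * X 0%N R.
Proof. by rewrite /fstep /= big_seq1. Qed.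

Lemma fstepS k X x y R : fstep k.+1 X x (y :: R) = (y == x)%:R * X 0%N R +
  \sum_(i <- iota 0 k.+1) cyc i (fun v => tau (tens x (X i.+1)) (y :: v)) R.
Proof.
rewrite /fstep [iota 0 k.+2]/= big_cons; congr (_ + _).
by rewrite -[1%N]/(1 + 0)%N -/(iota _ k.+1) iotaDl big_map.
Qed.

(** Only the diagonal coefficient of [tau] survives, since a corner [z] of [l] never has the letter
    of the addable [x]. As [x] varies with [R] fixed, these are the rows of a Cauchy system. *)
Lemma fstep_same k l X x R : addable x l -> R \in paths n k.+1 l ->
  fstep k.+1 X x (x :: R) = X 0%N R +
  \sum_(z <- rems l) invdiff x z * fstep k (fun i v => X i.+1 (z :: v)) z R.
Proof.
move=> ax hR; rewrite fstepS eqxx mul1r; congr (_ + _).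
under [RHS]eq_bigr do rewrite big_distrr.
rewrite exchange_big; apply: eq_bigr => i _ /=.
under [RHS]eq_bigr do rewrite -(linZ _ _ _ (@cyc_lin _ i)).
rewrite -(lin_sum _ _ _ (@cyc_lin _ i)); apply: (@cyc_local K n i k.+1 l) => // v.
case/pathsS => z [v' [-> hz _]] /=; rewrite eqxx mul1r.
rewrite (bigD1_seq z) ?uniq_rems ?mem_rems //= eqxx mul1r; congr (_ + _).
have -> : (z == x) = false.
  by apply/eqP => e; move: hz; rewrite e /removable; case/and3P: ax => ->.
rewrite mul0r mulr0 big1 // => q; rewrite eq_sym => /negPf ->.
by rewrite mul0r mulr0.
Qed.

(** Here only the off-diagonal coefficient survives: the tensor forces [x] to be the second
    letter. *)
Lemma fstep_diff k X x y R : y != x ->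
  fstep k.+1 X x (y :: R) = offdiag y x * fstep k (fun i v => X i.+1 (y :: v)) x R.
Proof.
move=> /negPf yx; rewrite fstepS yx mul0r add0r /fstep big_distrr.
apply: eq_bigr => i _ /=; rewrite -(linZ _ _ _ (@cyc_lin _ i)).
congr (cyc i _ R); apply/funext => -[|z v] /=; rewrite yx !mul0r mulr0 // add0r.
by case: eqP => [->|_]; rewrite // !mul0r !mulr0.
Qed.

(* The numerator of [a0 + \sum_z a z / (X - z)] has more roots than its degree. *)
Lemma cauchy_inj (zs xs : seq nat) (a0 : K) (a : nat -> K) :
  uniq zs -> uniq xs -> (size zs < size xs)%N -> {in xs, forall x, x \notin zs} ->
  {in xs, forall x, a0 + \sum_(z <- zs) invdiff x z * a z = 0} ->
  a0 = 0 /\ {in zs, forall z, a z = 0}.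
Proof.
move=> uz ux sz xz h.
pose prodX s : {poly K} := \prod_(z <- s) ('X - (z%:R)%:P).
have prodE s (b : K) : (prodX s).[b] = \prod_(z <- s) (b - z%:R).
  by rewrite horner_prod; apply: eq_bigr => z _; rewrite hornerXsubC.
pose p := a0 *: prodX zs + \sum_(z <- zs) a z *: prodX (rem z zs).
have p0 : p = 0.
  apply: (@roots_geq_poly_eq0 _ _ [seq x%:R | x <- xs]).
  - apply/allP => _ /mapP[x hx ->]; rewrite rootE hornerD hornerZ prodE horner_sum.
    have e z : z \in zs -> \prod_(z <- zs) (x%:R - z%:R) * (invdiff x z * a z) =
                 (a z *: prodX (rem z zs)).[x%:R] :> K.
      move=> hz; rewrite hornerZ prodE (big_rem _ hz) /= /invdiff.
      rewrite mulrACA divff ?mul1r 1?mulrC //.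
      by apply: diff_neq0; apply: contraNneq (xz _ hx) => ->.
    rewrite -(eq_big_seq _ e) -big_distrr /= mulrC -mulrDr h ?mulr0 //.
  - by rewrite map_inj_uniq // => x y /eqP; rewrite eqr_nat => /eqP.
  rewrite size_map; apply: leq_trans sz; apply: leq_trans (size_polyD _ _) _.
  rewrite geq_max; apply/andP; split.
    by apply: leq_trans (size_scale_leq _ _) _; rewrite size_prod_XsubC.
  rewrite big_seq; apply: leq_trans (size_sum _ _ _) _.
  apply/bigmax_leqP_seq => z hz _; apply: leq_trans (size_scale_leq _ _) _.
  by rewrite size_prod_XsubC size_rem //; case: (zs) hz.
have az : {in zs, forall z, a z = 0}.
  move=> z hz; have : p.[z%:R] = 0 by rewrite p0 horner0.
  rewrite hornerD hornerZ prodE (big_rem _ hz) /= subrr mul0r mulr0 add0r.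
  rewrite horner_sum (bigD1_seq z) //= big_seq_cond big1 ?addr0 => [|q].
    move/eqP; rewrite hornerZ prodE mulf_eq0 => /orP[/eqP //|].
    rewrite prodf_seq_eq0 => /hasP[q]; rewrite mem_rem_uniq // inE => /andP[qz _] /=.
    by rewrite (negPf (diff_neq0 _ _)) // eq_sym.
  case/andP=> hq qz; rewrite hornerZ prodE (big_rem z) /= ?subrr ?mul0r ?mulr0 //.
  by rewrite mem_rem_uniq // inE eq_sym qz.
split=> //; case: xs sz h {ux xz} => // x xs _ /(_ x (mem_head _ _)).
rewrite big_seq big1 ?addr0 // => z hz; by rewrite az // mulr0.
Qed.

(** For fixed [R] the outputs with head [x] form a Cauchy system whose unknowns are coset 0 and the
    steps of the smaller shapes at their own corner. The other outputs give the remaining steps of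
    [sw y l], as [x] and [y] are then far apart and the scaling factor is nonzero. Together these
    are the hypotheses of the induction for [sw y l]. *)
Lemma fstep_inj k l X : good n k l -> (k < n)%N ->
  (forall x P, addable x l -> P \in paths n k.+1 (sw x l) -> fstep k X x P = 0) ->
  forall i v, (i <= k)%N -> v \in paths n k l -> X i v = 0.
Proof.
elim: k l X => [|k IH] l X gl kn h i v ik hv.
  have [x ax] : exists x, addable x l.
    have := good_adds gl kn; have := mem_adds ^~ l.
    by case: (adds l) => // x s /(_ x) hx _; exists x; rewrite -hx mem_head.
  have := h x (x :: v) ax; rewrite fstep0 eqxx mul1r.
  move: ik; rewrite leqn0 => /eqP -> ; apply.
  by rewrite paths_cons removable_sw // swK // (addable_size ax).
have same R : R \in paths n k.+1 l -> X 0%N R = 0 /\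
    {in rems l, forall z, fstep k (fun i v => X i.+1 (z :: v)) z R = 0}.
  move=> hR; apply: (@cauchy_inj (rems l) (adds l)); rewrite ?uniq_rems ?uniq_adds //.
  - by rewrite (good_adds gl kn).
  - move=> x; rewrite mem_adds mem_rems /addable /removable => /and3P[-> _ _] //.
  move=> x; rewrite mem_adds => ax; rewrite -(fstep_same _ ax hR) h //.
  by rewrite paths_cons removable_sw // swK // (addable_size ax).
case: i ik => [|i] ik; first by have [] := same _ hv.
have [y [v' [-> hy hv']]] := pathsS hv; have ys := removable_size hy.
apply: (IH (sw y l) (fun i v => X i.+1 (y :: v)) _ _ _ i v') => //.
- exact/(good_removable _ _ hy).
- exact: ltnW.
move=> x R ax hR; case: (eqVneq y x) => [e|yx].
  by subst y; rewrite swK // in hR; have [_ ->] := same R hR; rewrite ?mem_rems.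
have f : far y x by apply: (addable_far (addable_sw hy) ax yx).
have f' : far x y by rewrite far_sym.
have axl : addable x l by rewrite -(addable_sw_far ys f).
have xs := addable_size axl.
have := h x (y :: R) axl; rewrite paths_cons /= removable_sw_far // hy.
rewrite (@swC y x) // hR => /(_ isT) /eqP; rewrite fstep_diff // mulf_eq0.
by rewrite offdiag_eq0 // f => /orP[//|/eqP].
Qed.

Lemma fourier_inj k phi : (k <= n)%N ->
  (forall l P Q, P \in paths n k l -> Q \in paths n k l -> fourier k phi P Q = 0) ->
  {in codes k, forall c, phi c = 0}.
Proof.
elim: k phi => [|k IH] phi kn h c.
  rewrite inE => /eqP ->; have := h (l0 n) [::] [::]; rewrite paths0 !eqxx => /(_ isT isT).
  by rewrite /fourier big_seq1 /= /delta eqxx mulr1.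
move=> hc; have [i [c' e]] := codesS hc; move: hc; rewrite e codes_cons => /andP[ik hc'].
apply: (IH (fun c => phi (i :: c))) hc' => [|l P Q hP hQ]; first exact: ltnW.
apply: (@fstep_inj k l (fun i v => fourier k (fun c => phi (i :: c)) v Q)) => //.
  exact: paths_good hP.
move=> x P' ax hP'; rewrite -fourierS; apply: h hP' _.
by rewrite paths_cons removable_sw // swK // (addable_size ax).
Qed.

End Fourier.

(** * Straight-line cost *)

Section Reach.
Variables (I : Type) (K : pzRingType).
Implicit Types (f : I -> K) (phi psi : (I -> K) -> K) (P : seq (instruction I K)).
Implicit Types (Phi Psi Xi : set ((I -> K) -> K)).

Definition avail P phi :=
  exists o : operand I K, forall f, read f (results f P) o = phi f.

Lemma results_cat f P P' :
  results f (P ++ P') = foldl (perform f) (results f P) P'.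
Proof. by rewrite /results foldl_cat. Qed.

Lemma foldl_perform f r P :
  exists2 t, foldl (perform f) r P = r ++ t & size t = size P.
Proof.
elim: P r => [|[[a b] c] P IH] r; first by exists [::]; rewrite ?cats0.
have [t e s] := IH (rcons r (read f r a * read f r b + read f r c)).
exists ((read f r a * read f r b + read f r c) :: t); last by rewrite /= s.
by rewrite /= e cat_rcons.
Qed.

Lemma size_results f P : size (results f P) = size P.
Proof. by rewrite /results; have [t -> <-] := foldl_perform f [::] P. Qed.

Lemma avail_cat P P' phi : avail P phi -> avail (P ++ P') phi.
Proof.
case=> [[i|c|j] h]; [by exists (Input i)|by exists (Const c)|].
case: (ltnP j (size P)) => hj.
  exists (Step j) => f; rewrite -h /= results_cat.
  by have [t -> _] := foldl_perform f (results f P) P'; rewrite nth_cat size_results hj.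
(* A step index beyond [P] reads 0 now but might read a genuine result once [P'] is appended, so a
   constant replaces it. *)
exists (Const 0) => f; rewrite -h /= nth_default //.
by rewrite size_results.
Qed.

(** Quantifying over the program already run makes costs additive and lets earlier results be
    shared. *)
Definition reach m Phi Psi := forall P, (forall phi, Phi phi -> avail P phi) ->
  exists2 P', (size P' <= m)%N & forall psi, Psi psi -> avail (P ++ P') psi.

Lemma reach_weaken m m' Phi Phi' Psi Psi' : (m <= m')%N ->
  (forall phi, Phi phi -> Phi' phi) -> (forall psi, Psi' psi -> Psi psi) ->
  reach m Phi Psi -> reach m' Phi' Psi'.
Proof.
move=> mm PP SS h P hP; have [|P' s hP'] := h P; first by move=> phi /PP /hP.
exists P'; first exact: leq_trans mm.
by move=> psi /SS /hP'.
Qed.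

Lemma reach_trans a b Phi Psi Xi :
  reach a Phi Psi -> reach b Psi Xi -> reach (a + b) Phi Xi.
Proof.
move=> h1 h2 P /h1[P1 s1 /h2[P2 s2 h]]; exists (P1 ++ P2); last by rewrite catA.
by rewrite size_cat leq_add.
Qed.

Lemma reach_cup a b Phi Psi Xi : reach a Phi Psi -> reach b Phi Xi ->
  reach (a + b) Phi (fun phi => Psi phi \/ Xi phi).
Proof.
move=> h1 h2 P hP; have [P1 s1 h] := h1 P hP.
have [|P2 s2 h'] := h2 (P ++ P1); first by move=> phi /hP; apply: avail_cat.
exists (P1 ++ P2); first by rewrite size_cat leq_add.
by rewrite catA => psi [/h|/h'//]; apply: avail_cat.
Qed.

Lemma reach_sum (J : eqType) (s : seq J) (m : J -> nat) Phi (Psi : J -> set ((I -> K) -> K)) :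
  (forall j, j \in s -> reach (m j) Phi (Psi j)) ->
  reach (\sum_(j <- s) m j) Phi (fun phi => exists2 j, j \in s & Psi j phi).
Proof.
elim: s => [|j s IH] h.
  by move=> P _; exists [::] => // psi [j]; rewrite in_nil.
rewrite big_cons; apply: reach_weaken (reach_cup (h j (mem_head _ _)) (IH _)) => //.
- by move=> psi [q]; rewrite inE => /predU1P[-> ?|? ?]; [left|right; exists q].
- by move=> q qs; apply: h; rewrite inE qs orbT.
Qed.

Lemma reach_free Phi Psi :
  (forall P, (forall phi, Phi phi -> avail P phi) ->
     forall psi, Psi psi -> avail P psi) -> reach 0 Phi Psi.
Proof. by move=> h P hP; exists [::] => // psi; rewrite cats0; apply: h. Qed.

Lemma reach_scale (a : K) phi Phi : Phi phi ->
  reach 1 Phi (fun psi => psi = fun f => a * phi f).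
Proof.
move=> h P hP; have [q ho] := hP _ h.
exists [:: (Const a, q, Const 0)] => // _ ->; exists (Step (size P)) => f.
by rewrite results_cat /= nth_rcons size_results ltnn eqxx ho addr0.
Qed.

(** Each operation accumulates one product onto the partial sum. Starting from [phi0], the term with
    coefficient 1 is free. *)
Lemma reach_lincomb (J : eqType) (s : seq J) (a : J -> K) (phi : J -> (I -> K) -> K)
    phi0 Phi : Phi phi0 -> {in s, forall j, Phi (phi j)} ->
  reach (size s) Phi (fun psi => psi = fun f => phi0 f + \sum_(j <- s) a j * phi j f).
Proof.
move=> h0; elim/last_ind: s => [|s j IH] h.
  apply: reach_free => P hP _ ->.
  by have [q ho] := hP _ h0; exists q => f; rewrite ho big_nil addr0.
have hs : {in s, forall j, Phi (phi j)} by move=> q qs; apply: h; rewrite mem_rcons inE qs orbT.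
move=> P hP; have [P' sP hP'] := IH hs P hP.
have [q ho] := hP' _ erefl.
have hj : Phi (phi j) by apply: h; rewrite mem_rcons mem_head.
have [oj hoj] := avail_cat P' (hP _ hj).
exists (rcons P' (Const (a j), oj, q)); first by rewrite !size_rcons.
move=> _ ->; exists (Step (size (P ++ P'))) => f; rewrite -rcons_cat /=.
rewrite -cats1 results_cat /= nth_rcons size_results ltnn eqxx ho hoj.
by rewrite -cats1 big_cat big_seq1 /= [LHS]addrC -addrA.
Qed.

End Reach.

Section Cost.
Variables (I : Type) (K : numClosedFieldType) (n : nat).
Implicit Types (l : seq bool) (i k m x y z : nat) (w v c u P Q R : seq nat).

(** For a shape with k + 1 boxes and r corners the new operations number at most (k + 2) + r(r + 1)
    <= 3k + 4 per tableau of the shape, while 3 (k + 2)^2 exceeds 3 (k + 1)^2 by 6k + 9. *)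
Lemma reach_fstep k l (X : nat -> seq nat -> (I -> K) -> K) :
  good n k l -> (k < n)%N ->
  reach (3 * k.+1 ^ 2 * size (paths n k l))
    (fun phi => exists i v, [/\ (i <= k)%N, v \in paths n k l & phi = X i v])
    (fun phi => exists x P, [/\ addable x l, P \in paths n k.+1 (sw x l) &
       phi = fun f => fstep k (fun i v => X i v f) x P]).
Proof.
elim: k l X => [|k IH] l X gl kn.
  apply: (@reach_weaken _ _ 0 _ _ _ _ _ (leq0n _) (fun _ => id) (fun _ => id)).
  apply: reach_free => P hP _ [x [Q [ax hQ ->]]].
  have [y [R [-> hy hR]]] := pathsS hQ.
  case: (eqVneq y x) => [e|/negPf yx].
    subst y; rewrite swK ?(addable_size ax) // in hR; rewrite paths0 in hR.
    case/andP: hR => /eqP -> /eqP el; have [|q ho] := hP (X 0%N [::]).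
      by exists 0%N, [::]; rewrite el paths0 !eqxx.
    by exists q => f; rewrite ho fstep0 eqxx mul1r.
  by exists (Const 0) => f; rewrite fstep0 yx mul0r.
set Phi := (fun phi => _); set r := size (rems l); set d := size (paths n k.+1 l).
pose Psi y := fun phi : (I -> K) -> K =>
  exists x P, [/\ addable x (sw y l), P \in paths n k.+1 (sw x (sw y l)) &
     phi = fun f => fstep k (fun i v => X i.+1 (y :: v) f) x P].
pose Phi1 := fun phi => Phi phi \/ exists2 y, y \in rems l & Psi y phi.
have st1 : reach (3 * k.+1 ^ 2 * d) Phi Phi1.
  have h0 : reach 0 Phi Phi by apply: reach_free.
  have := @reach_cup _ _ 0 (\sum_(y <- rems l) 3 * k.+1 ^ 2 * size (paths n k (sw y l)))
    Phi Phi (fun phi => exists2 y, y \in rems l & Psi y phi) h0.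
  rewrite add0n -big_distrr /= -size_pathsS; apply.
  rewrite size_pathsS big_distrr /=; apply: reach_sum.
  move=> y; rewrite mem_rems => hy.
  apply: reach_weaken (IH (sw y l) (fun i v => X i.+1 (y :: v)) _ _) => //.
  - move=> _ [i [v [ik hv ->]]]; exists i.+1, (y :: v); split=> //.
    by rewrite paths_cons hy.
  - exact/(good_removable _ _ hy).
  - exact: ltnW.
(* The cost of one output: a row of the Cauchy matrix if the head is the added letter, one scaling
   otherwise. *)
pose m x P := if ohead P == Some x then r else 1%N.
have st2 : reach (\sum_(x <- adds l) \sum_(P <- paths n k.+2 (sw x l)) m x P) Phi1
   (fun phi => exists2 x, x \in adds l & exists2 P, P \in paths n k.+2 (sw x l) &
       phi = fun f => fstep k.+1 (fun i v => X i v f) x P).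
  apply: reach_sum => x; rewrite mem_adds => ax; apply: reach_sum => P hP.
  have [y [R [eP hy hR]]] := pathsS hP; rewrite {}eP /m /=.
  case: (eqVneq y x) => [e|yx].
    subst y; rewrite swK ?(addable_size ax) // in hR; rewrite eqxx.
    pose phi z := fun f => fstep k (fun i v => X i.+1 (z :: v) f) z R.
    have c0 : Phi1 (X 0%N R) by left; exists 0%N, R.
    have c : {in rems l, forall z, Phi1 (phi z)}.
      move=> z; rewrite mem_rems => hz; right; exists z; rewrite ?mem_rems //.
      exists z, R; split=> //; first exact: addable_sw.
      by rewrite swK // (removable_size hz).
    apply: reach_weaken (reach_lincomb (invdiff K x) c0 c) => // _ ->.
    by apply/funext => f; exact: fstep_same ax hR.
  have -> : (Some y == Some x) = false by apply/eqP => -[/eqP]; rewrite (negPf yx).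
  have f : far y x by apply: removable_far hy (removable_sw ax) yx.
  have f' : far x y by rewrite far_sym.
  have xs := addable_size ax.
  have hyl : removable y l by rewrite -(removable_sw_far xs f').
  have ys := removable_size hyl.
  pose phi := fun f => fstep k (fun i v => X i.+1 (y :: v) f) x R.
  have c : Phi1 phi.
    right; exists y; rewrite ?mem_rems //; exists x, R; split=> //.
      by rewrite addable_sw_far.
    by rewrite swC.
  apply: reach_weaken (reach_scale (offdiag K y x) c) => // _ ->.
  by apply/funext => f0; exact: fstep_diff.
apply: reach_weaken (reach_trans st1 st2) => //; last first.
  by move=> _ [x [P [ax hP ->]]]; exists x; rewrite ?mem_adds //; exists P.
(* Each of the [r.+1] addable letters heads [d] outputs of cost [r]; all outputs together number
   [k.+2 * d]. *)
have bm : (\sum_(x <- adds l) \sum_(P <- paths n k.+2 (sw x l)) m x P <=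
   k.+2 * d + r.+1 * (r * d))%N.
  rewrite -sum_paths_adds // -/r -(good_adds gl kn) -(sum1_size (adds l)) big_distrl -big_split /=.
  rewrite !big_seq; apply: leq_sum => x; rewrite mem_adds => ax.
  rewrite size_pathsS (pathsE n k.+1) big_flatten big_map.
  rewrite !(perm_big _ (perm_rems_sw ax)) !big_cons swK ?(addable_size ax) // big_map.
  have -> : (\sum_(w <- paths n k.+1 l) m x (x :: w) = r * d)%N.
    by rewrite /m /= eqxx big_const_seq iter_addn_0 count_predT.
  rewrite /= mul1n addnC leq_add2r.
  apply: leq_trans (leq_addl _ _); rewrite !big_seq; apply: leq_sum => y.
  rewrite mem_filter => /andP[f _]; rewrite big_map /m /= -sum1_size.
  apply: leq_sum => w _; case: eqP => // -[e]; move: f; rewrite e /far; lia.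
apply: leq_trans (leq_add (leqnn _) bm) _; have [_ _ il] := gl.
have := rems_inv l; rewrite il -/r; nia.
Qed.

Lemma reach_fourier k (phi : seq nat -> (I -> K) -> K) : (k <= n)%N ->
  reach (3 * k ^ 2 * k`!)
    (fun psi => exists2 c, c \in codes k & psi = phi c)
    (fun psi => exists l P Q, [/\ P \in paths n k l, Q \in paths n k l &
       psi = fun f => fourier k (fun c => phi c f) P Q]).
Proof.
elim: k phi => [|k IH] phi kn.
  apply: reach_free => P hP _ [l [v [w [hv hw ->]]]].
  have [|q ho] := hP (phi [::]); first by exists [::]; rewrite ?inE.
  exists q => f; rewrite ho /fourier big_seq1 /= /delta.
  by move: hv hw; rewrite !paths0 => /andP[/eqP -> _] /andP[/eqP -> _]; rewrite mulr1.
set Phi := (fun psi => _).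
pose X (Q : seq nat) i v := fun f => fourier k (fun c => phi (i :: c) f) v Q.
have st1 : reach (\sum_(i <- iota 0 k.+1) 3 * k ^ 2 * k`!) Phi
    (fun psi => exists2 i, i \in iota 0 k.+1 & exists l P Q,
      [/\ P \in paths n k l, Q \in paths n k l & psi = X Q i P]).
  apply: reach_sum => i; rewrite mem_iota => ik.
  have h := IH (fun c => phi (i :: c)) (ltnW kn).
  refine (reach_weaken (leqnn _) _ (fun _ => id) h).
  by move=> _ [c hc ->]; exists (i :: c); rewrite ?codes_cons ?hc ?andbT.
(* Each column [Q] is a separate instance of the intertwiner, costing in proportion to the degree of
   its shape; over all [Q] these degrees sum to k!. *)
have st2 : reach (\sum_(Q <- allpaths n k) 3 * k.+1 ^ 2 * size (paths n k (endpt n Q)))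
    (fun psi => exists2 i, i \in iota 0 k.+1 & exists l P Q,
      [/\ P \in paths n k l, Q \in paths n k l & psi = X Q i P])
    (fun psi => exists2 Q, Q \in allpaths n k & exists x P,
       [/\ addable x (endpt n Q), P \in paths n k.+1 (sw x (endpt n Q)) &
        psi = fun f => fstep k (fun i v => X Q i v f) x P]).
  apply: reach_sum => Q hQ.
  have hQ' : Q \in paths n k (endpt n Q) by rewrite paths_allpaths hQ eqxx.
  refine (reach_weaken (leqnn _) _ (fun _ => id) (@reach_fstep _ _ (X Q) (paths_good hQ') kn)).
  move=> _ [i [v [ik hv ->]]]; exists i; first by rewrite mem_iota.
  by exists (endpt n Q), v, Q.
apply: reach_weaken (reach_trans st1 st2) => //.
  rewrite big_const_seq count_predT size_iota iter_addn_0.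
  rewrite -[X in (_ + X)%N]big_distrr /= sum_allpaths ?(ltnW kn) // factS; nia.
move=> _ [l [P [Q' [hP hQ ->]]]]; have [x [Q [-> hx {}hQ]]] := pathsS hQ.
move: (hQ); rewrite paths_allpaths => /andP[hQ1 /eqP eQ].
exists Q => //; exists x, P; rewrite eQ swK ?(removable_size hx) //; split=> //.
  exact: addable_sw.
by apply/funext => f; rewrite fourierS.
Qed.

End Cost.

(** * The rook monoid and its groupoid *)

Section Words.
Variable n : nat.
Implicit Types (s t : rook n) (A B : {set 'I_n}).

Definition images s : seq 'I_n := pmap s (enum 'I_n).
Definition ran s : {set 'I_n} := [set y in images s].
(** The permutation obtained from [s] by numbering its domain and its range increasingly. *)
Definition code s : seq nat := lehmer (map val (images s)).

Lemma enum_setE A : enum A = [seq x <- enum 'I_n | x \in A].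
Proof. by rewrite enumT. Qed.

Lemma mem_ran s y : reflect (exists x, s x = Some y) (y \in ran s).
Proof.
rewrite inE mem_pmap; apply: (iffP mapP) => [[x _ e]|[x e]]; first by exists x.
by exists x; rewrite ?mem_enum.
Qed.

Lemma mem_pdom s x : (x \in pdom s) = (s x != None).
Proof. by rewrite inE. Qed.

Lemma pmap_uniq_in (T : eqType) (U : eqType) (f : T -> option U) (e : seq T) :
  (forall x y, f x != None -> f x = f y -> x = y) -> uniq e -> uniq (pmap f e).
Proof.
move=> fi; elim: e => //= x e IH /andP[xe ue].
case fx: (f x) => [a|] /=; last exact: IH.
rewrite IH // andbT mem_pmap; apply/mapP => -[y ye e'].
by move: xe; rewrite (fi x y) ?ye // fx.
Qed.

Lemma uniq_images s : uniq (images s).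
Proof. by apply: pmap_uniq_in; [exact: (@rook_injP n s) | exact: enum_uniq]. Qed.

Lemma size_images s : size (images s) = rank s.
Proof.
rewrite /images size_pmap count_map /rank cardE -size_filter; congr size.
rewrite enum_setE -!enumT; apply: eq_filter => x /=.
by rewrite mem_pdom; case: (s x).
Qed.

Lemma card_ran s : #|ran s| = rank s.
Proof. by rewrite cardsE -size_images; apply/card_uniqP; exact: uniq_images. Qed.

Lemma code_codes s : code s \in codes (rank s).
Proof. by rewrite -size_images -(size_map val); exact: lehmer_codes. Qed.

Lemma pmap_comp (T U V : Type) (f : U -> option V) (g : T -> option U) (e : seq T) :
  pmap (fun x => obind f (g x)) e = pmap f (pmap g e).
Proof. by elim: e => //= x e IH; case: (g x) => [a|] //=; rewrite IH. Qed.

Lemma images_mul s t : images (s * t)%g = pmap s (images t).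
Proof.
rewrite /images -pmap_comp; apply: eq_pmap => x.
exact: ffunE.
Qed.

(* Junk value 0 outside the domain of [s]. *)
Definition extension s (y : nat) : nat :=
  if insub y is Some i then (if s i is Some j then val j else 0%N) else 0%N.

Lemma extensionE s (i j : 'I_n) : s i = Some j -> extension s i = j.
Proof. by move=> e; rewrite /extension valK e. Qed.

Lemma map_extension s (e : seq 'I_n) : {subset e <= pdom s} ->
  map val (pmap s e) = map (extension s) (map val e).
Proof.
elim: e => //= x e IH h; have := h x (mem_head _ _); rewrite mem_pdom.
case e1: (s x) => [a|] //= _; rewrite (extensionE e1) IH // => y ye.
by apply: h; rewrite inE ye orbT.
Qed.

Lemma images_dom s : images s = pmap s (enum (pdom s)).
Proof.
rewrite /images enum_setE; elim: (enum _) => //= x e IH.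
by rewrite mem_pdom; case e1: (s x) => [a|] /=; rewrite ?e1 /= IH.
Qed.

(** An instance of [repr_comp]: the sorted word is the range of [t], the permuted word the images of
    [t], and the relabelling of letters is [s] itself. *)
Lemma code_comp (K : numClosedFieldType) s t k l P (F : seq nat -> K) :
  pdom s = ran t -> (rank t <= k)%N -> P \in paths n k l ->
  repr (code (s * t)%g) F P = repr (code s) (repr (code t) F) P.
Proof.
move=> st tk hP; rewrite /code images_mul (images_dom s) st.
have sub1 : {subset images t <= pdom s} by move=> x xt; rewrite st inE.
have sub2 : {subset enum (ran t) <= pdom s} by move=> x; rewrite mem_enum st.
rewrite (map_extension sub1) (map_extension sub2).
have srt : sorted ltn (map val (enum (ran t))).
  rewrite enum_setE; apply: (subseq_sorted ltn_trans (s2 := iota 0 n)).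
    by rewrite -val_enum_ord; apply/map_subseq/filter_subseq.
  exact: iota_ltn_sorted.
have prm : perm_eq (map val (enum (ran t))) (map val (images t)).
  apply/perm_map/uniq_perm; rewrite ?enum_uniq ?uniq_images // => x.
  by rewrite mem_enum inE.
have inj : {in map val (images t) &, injective (extension s)}.
  move=> _ _ /mapP[i it ->] /mapP[j jt ->].
  have := sub1 _ it; have := sub1 _ jt; rewrite !mem_pdom.
  case ej: (s j) => [b|] // _; case ei: (s i) => [a|] // _.
  rewrite (extensionE ej) (extensionE ei) => /val_inj ab.
  by congr val; apply: (@rook_injP n s); rewrite ei // ej ab.
have mk : (size (map val (images t)) <= k)%N by rewrite size_map size_images.
exact: (repr_comp srt prm inj F mk hP).
Qed.

(** The first digit is the rank of the head among all letters, which are the same for both words,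
    and so determines it. *)
Lemma lehmer_inj u v : uniq u -> perm_eq u v -> lehmer u = lehmer v -> u = v.
Proof.
elim: u v => [|x u IH] [|y v] //=.
move=> /andP[xu uu] p [e1 e2].
have exy : x = y.
  have c z : (count (fun a => (a < z)%N) (x :: u) = count (fun a => (a < z)%N) (y :: v)).
    exact/permP.
  have h a b (r : seq nat) : (a < b)%N ->
    (count (fun c => (c < a)%N) r <= count (fun c => (c < b)%N) r)%N.
    by move=> ab; apply: sub_count => z /= /leq_trans; apply; exact: ltnW.
  have c1 := c x; have c2 := c y; rewrite /= !ltnn !add0n in c1 c2.
  case: (ltngtP x y) => // xy.
    by have := h _ _ u xy; have := h _ _ v xy; move: c1 c2 e1; rewrite xy ltnNge (ltnW xy) /=; lia.
  by have := h _ _ u xy; have := h _ _ v xy; move: c1 c2 e1; rewrite xy ltnNge (ltnW xy) /=; lia.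
by subst y; rewrite (IH v) //; rewrite -(perm_cons x).
Qed.

Lemma pmap_inj_in (T U : eqType) (f g : T -> option U) (e : seq T) :
  (forall x, (f x == None) = (g x == None)) -> pmap f e = pmap g e ->
  {in e, f =1 g}.
Proof.
move=> fg; elim: e => //= x e IH; have := fg x.
case fx: (f x) => [a|]; case gx: (g x) => [b|] //= _.
  move=> [ab /IH h] y; rewrite inE => /predU1P[->|/h //].
  by rewrite fx gx ab.
move=> /IH h y; rewrite inE => /predU1P[->|/h //].
by rewrite fx gx.
Qed.

Lemma code_inj s t : pdom s = pdom t -> ran s = ran t -> code s = code t -> s = t.
Proof.
move=> ed er ec; have im : images s = images t.
  apply: (inj_map val_inj); apply: lehmer_inj ec.
    by rewrite map_inj_uniq ?uniq_images //; exact: val_inj.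
  apply/perm_map/uniq_perm; rewrite ?uniq_images // => x.
  by have := congr1 (fun S : {set 'I_n} => x \in S) er; rewrite !inE.
apply/val_inj/ffunP => x; apply: (pmap_inj_in _ im); last by rewrite mem_enum.
move=> y; apply: negb_inj.
by have := congr1 (fun S : {set 'I_n} => y \in S) ed; rewrite !mem_pdom.
Qed.

Lemma card_pdom_eq A : (n ^_ #|A| <= #|[set s : rook n | pdom s == A]|)%N.
Proof.
pose T : finType := {x : 'I_n | x \in A}.
have cT : #|T| = #|A| by rewrite card_sig; apply: eq_card.
have := card_inj_ffuns T 'I_n; rewrite card_ord cT => <-.
pose ext (f : {ffun T -> 'I_n}) : {ffun 'I_n -> option 'I_n} :=
  [ffun x => omap f (insub x)].
have extP (f : {ffun T -> 'I_n}) : injectiveb f -> dinjectiveb (ext f) (pdom (ext f)).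
  move=> /injectiveP fi; apply/dinjectiveP => x y; rewrite !inE !ffunE.
  case: insubP => //= a _ ea; case: insubP => //= b _ eb _ _ [/fi ab].
  by rewrite -ea -eb ab.
pose mk (f : {ffun T -> 'I_n}) : rook n :=
  if insub (ext f) is Some r then r else 1%g.
have mkE (f : {ffun T -> 'I_n}) : injectiveb f -> rook_val (mk f) = ext f.
  by move=> fi; rewrite /mk insubT ?extP.
rewrite -(card_in_imset (f := mk)).
  apply/subset_leq_card/fintype.subsetP => r /imsetP[f]; rewrite !inE => fi ->.
  apply/eqP/setP => x; rewrite mem_pdom mkE // ffunE.
  by case: insubP => [a -> _|/negPf ->].
move=> f g; rewrite !inE => fi gi e; apply/ffunP => a.
have := congr1 (fun r : rook n => r (val a)) e; rewrite /= !mkE // !ffunE valK /=.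
by case.
Qed.

End Words.

(** * Restrictions of rooks and Moebius inversion in the natural order *)

Section Restriction.
Variable n : nat.
Implicit Types (s t u : rook n) (A B : {set 'I_n}).

Fact res_subproof s A :
  let r := [ffun x => if x \in A then s x else None] in dinjectiveb r (pdom r).
Proof.
apply/dinjectiveP => x y; rewrite !inE !ffunE.
by case: ifP => // _; case: ifP => // _ sx _; exact: rook_injP.
Qed.

Definition res s A : rook n := Rook (res_subproof s A).

Lemma resE s A x : res s A x = if x \in A then s x else None.
Proof. exact: ffunE. Qed.

Lemma mulrE s t x : (s * t)%g x = obind s (t x).
Proof. exact: ffunE. Qed.

Lemma rookP s t : (forall x, s x = t x) -> s = t.
Proof. by move=> h; apply/val_inj/ffunP. Qed.

Lemma pdom_res s A : pdom (res s A) = A :&: pdom s.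
Proof. by apply/setP => x; rewrite finset.in_setI !mem_pdom resE; case: ifP. Qed.

Lemma res_id s : res s (pdom s) = s.
Proof.
apply: rookP => x; rewrite resE; case: ifP => //.
by rewrite mem_pdom => /negbFE/eqP.
Qed.

Lemma res_res s A B : B \subset A -> res (res s A) B = res s B.
Proof.
move=> /fintype.subsetP BA; apply: rookP => x; rewrite !resE.
by case: ifP => // /BA ->.
Qed.

Lemma sum_le (V : nmodType) s (F : rook n -> V) :
  \sum_(t | rook_le t s) F t = \sum_(A : {set 'I_n} | A \subset pdom s) F (res s A).
Proof.
rewrite (reindex_onto (res s) (fun t => pdom t)) /=.
  apply: eq_bigl => A; rewrite pdom_res; apply/andP/finset.setIidPl => [[_ /eqP //]|e].
  rewrite e eqxx; split=> //; apply/forall_inP => x; rewrite mem_pdom resE.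
  by case: ifP => // _; rewrite eqxx.
move=> t /forall_inP h; apply: rookP => x; rewrite resE; case: ifP => hx.
  by apply/esym/eqP/h.
by move: hx; rewrite mem_pdom => /negbFE/eqP.
Qed.

Lemma pdom_mul s t : ran t \subset pdom s -> pdom (s * t)%g = pdom t.
Proof.
move=> /fintype.subsetP h; apply/setP => x; rewrite !mem_pdom mulrE.
case tx: (t x) => [a|] //=; rewrite -mem_pdom h //.
by apply/mem_ran; exists x.
Qed.

Lemma ran_mul s t : pdom s = ran t -> ran (s * t)%g = ran s.
Proof.
move=> h; apply/setP => y; apply/mem_ran/mem_ran => -[x].
  by rewrite mulrE; case tx: (t x) => [a|] //= sa; exists a.
move=> sx; have : x \in ran t by rewrite -h mem_pdom sx.
by case/mem_ran => z tz; exists z; rewrite mulrE tz.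
Qed.

Lemma ran_res_sub s t A : (A \subset pdom t) && (ran (res t A) \subset pdom s) =
  (A \subset pdom (s * t)%g).
Proof.
apply/andP/fintype.subsetP => [[/fintype.subsetP h1 /fintype.subsetP h2] x xA|h].
  have := h1 x xA; rewrite !mem_pdom mulrE; case tx: (t x) => [a|] //= _.
  by rewrite -mem_pdom h2 //; apply/mem_ran; exists x; rewrite resE xA.
split; apply/fintype.subsetP => x.
  by move=> /h; rewrite !mem_pdom mulrE; case: (t x).
case/mem_ran => y; rewrite resE; case: ifP => // /h.
by rewrite !mem_pdom mulrE => h' ty; move: h'; rewrite ty.
Qed.

Lemma res_mul s t A : A \subset pdom t ->
  (res s (ran (res t A)) * res t A)%g = res (s * t)%g A.
Proof.
move=> At; apply: rookP => x; rewrite mulrE [in RHS]resE mulrE.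
case xA: (x \in A); rewrite [res t A x]resE xA //.
case tx: (t x) => [a|] //=; rewrite resE.
by have -> : a \in ran (res t A) by apply/mem_ran; exists x; rewrite resE xA.
Qed.

(** Moebius inversion in a Boolean lattice: toggling an element of [D] outside [B] reverses the
    sign. *)
Lemma alternating_sum (R : pzRingType) (D B : {set 'I_n}) : B \subset D ->
  \sum_(A : {set 'I_n} | (B \subset A) && (A \subset D)) (-1) ^+ (#|D| - #|A|)
    = (B == D)%:R :> R.
Proof.
move=> BD; case: eqVneq => [->|BnD] /=.
  rewrite (bigD1 D) ?subxx //= subnn expr0 big1 ?addr0 // => A.
  by rewrite -finset.eqEsubset eq_sym => /andP[/eqP ->]; rewrite eqxx.
have /properP[_ [x xD xB]] : B \proper D by rewrite finset.properEneq BnD BD.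
rewrite (bigID (fun A : {set 'I_n} => x \in A)) /=.
rewrite (reindex_onto (fun A : {set 'I_n} => x |: A) (fun A => A :\ x)) /=; last first.
  by move=> A /andP[_ xA]; rewrite finset.setD1K.
rewrite -[X in X + _]opprK addrC; apply/eqP; rewrite subr_eq0 -sumrN; apply/eqP.
rewrite [RHS](_ : _ = \sum_(A : {set 'I_n} | (B \subset A) && (A \subset D) && (x \notin A))
   - (-1) ^+ (#|D| - #|x |: A|)).
  apply: eq_bigr => A /andP[/andP[BA AD] xA].
  have := subset_leq_card (_ : x |: A \subset D); rewrite finset.subUset finset.sub1set xD AD cardsU1 xA.
  move=> /(_ isT) h; rewrite -[(#|D| - #|A|)%N]prednK ?subn_gt0 //.
  by rewrite exprS mulN1r add1n subnS.
apply: eq_bigl => A; case xA: (x \in A); last first.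
  rewrite !finset.setU1K ?xA // eqxx finset.setU11 !andbT finset.subUset finset.sub1set xD /=; congr (_ && _).
  by have := finset.subsetD1 B (x |: A) x; rewrite finset.setU1K ?xA // xB andbT => ->.
by rewrite andbF; apply/negbTE/negP => /andP[_ /eqP e]; move: xA; rewrite -e !inE eqxx.
Qed.

End Restriction.

(** * Matrix coefficients of the groupoid and of the monoid *)

Section Coefficients.
Variables (K : numClosedFieldType) (n : nat).
Implicit Types (s t u : rook n) (A B : {set 'I_n}) (l : seq bool) (P Q : seq nat).

Lemma uniq_allpaths k : uniq (allpaths n k).
Proof.
elim: k => // k IH; apply: allpairs_uniq_dep => // [w _|[a b] [c d] _ _ /= [-> ->] //].
exact: uniq_adds.
Qed.

Lemma uniq_codes k : uniq (codes k).
Proof.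
elim: k => // k IH; apply: allpairs_uniq => //; first exact: iota_uniq.
by move=> [a b] [c d] _ _ /= [-> ->].
Qed.

(* A row index is a standard tableau filled with the elements of a subset. *)
Definition tableaux : seq ({set 'I_n} * seq nat) :=
  [seq (B, Q) | B <- enum {set 'I_n}, Q <- allpaths n #|B|].

Definition tab : finType := seq_sub tableaux.
Definition cl (w : tab) : seq bool := endpt n (val w).2.
Implicit Types w : tab.

Lemma mem_tableaux B Q : ((B, Q) \in tableaux) = (Q \in allpaths n #|B|).
Proof.
apply/allpairsPdep/idP => [[B' [Q' [_ h [-> ->]]]] //|h].
by exists B, Q; rewrite mem_enum.
Qed.

Lemma uniq_tableaux : uniq tableaux.
Proof.
apply: allpairs_uniq_dep => [|B _|[a b] [c d] _ _ /= [-> ->] //].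
  exact: enum_uniq.
exact: uniq_allpaths.
Qed.

Lemma sum_tab_cond (V : nmodType) (p : pred ({set 'I_n} * seq nat))
    (F : {set 'I_n} * seq nat -> V) :
  \sum_(w : tab | p (val w)) F (val w) =
  \sum_(B : {set 'I_n}) \sum_(Q <- allpaths n #|B| | p (B, Q)) F (B, Q).
Proof.
transitivity (\sum_(q <- tableaux | p q) F q).
  have e : perm_eq (map val (enum tab)) tableaux.
    apply: uniq_perm; [|exact: uniq_tableaux|].
      by rewrite (map_inj_uniq val_inj) enum_uniq.
    move=> q; apply/mapP/idP => [[w _ ->]|hq]; first exact: valP.
    by exists (SeqSub hq); rewrite ?mem_enum.
  by rewrite -(perm_big _ e) big_map big_enum_cond.
rewrite big_flatten big_map big_enum; apply: eq_bigr => B _ /=.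
by rewrite big_map.
Qed.

Lemma sum_tab (V : nmodType) l (F : {set 'I_n} * seq nat -> V) :
  \sum_(w : tab | cl w == l) F (val w) =
  \sum_(B : {set 'I_n}) \sum_(Q <- paths n #|B| l) F (B, Q).
Proof.
rewrite (sum_tab_cond (fun q => endpt n q.2 == l)); apply: eq_bigr => B _ /=.
rewrite -big_filter; apply/perm_big/uniq_perm.
- by rewrite filter_uniq // uniq_allpaths.
- exact: uniq_paths.
by move=> Q; rewrite mem_filter paths_allpaths andbC.
Qed.

Lemma tab_path w : (val w).2 \in paths n #|(val w).1| (cl w).
Proof.
by rewrite paths_allpaths eqxx andbT -mem_tableaux -surjective_pairing; exact: valP.
Qed.

(** The coefficient of the groupoid element floor(s). Rows carry the range and columns the domain
    because maps act on the left. *)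
Definition gcoef s (p q : {set 'I_n} * seq nat) : K :=
  if (pdom s == q.1) && (ran s == p.1) then repr (code s) (delta K q.2) p.2 else 0.

(** The groupoid law: floor(s) floor(t) is floor(s t) if the domain of [s] is the range of [t], and
    0 otherwise. Only the intermediate subset [ran t] contributes, where [code_comp] applies. *)
Lemma gcoef_mul s t w w'' : cl w = cl w'' ->
  \sum_(w' : tab | cl w' == cl w'') gcoef s (val w) (val w') * gcoef t (val w') (val w'') =
  if pdom s == ran t then gcoef (s * t)%g (val w) (val w'') else 0.
Proof.
move=> ww; rewrite (sum_tab _ (fun p => gcoef s (val w) p * gcoef t p (val w''))).
rewrite (bigD1 (ran t)) //= [X in _ + X]big1 ?addr0; last first.
  move=> B BT; rewrite big1 // => Q _.
  by rewrite /gcoef /= eq_sym in BT *; rewrite (negPf BT) andbF mulr0.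
rewrite /gcoef /= eqxx andbT; case: eqP => [st|_] /=; last first.
  by rewrite big1 // => Q _; rewrite mul0r.
rewrite ran_mul // pdom_mul ?st //.
case e1: (ran s == (val w).1); last first.
  by rewrite andbF big1 // => Q _; rewrite mul0r.
case e2: (pdom t == (val w'').1); last first.
  by rewrite /= big1 // => Q _; rewrite mulr0.
have hP : (val w).2 \in paths n #|ran t| (cl w'').
  by have := tab_path w; rewrite ww -(eqP e1) card_ran /rank st.
rewrite /= (code_comp _ st _ hP) ?card_ran //.
by rewrite (local_expand _ (@repr_lin K _) (@repr_local K n _) hP) card_ran.
Qed.

Definition zeta s w w' : K := \sum_(t | rook_le t s) gcoef t (val w) (val w').

(** A restriction of [s * t] factors in exactly one composable way: the restriction of [t], followed
    by [s] restricted to its range. All other pairs contribute 0. *)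
Lemma zeta_mul s t w w'' : cl w = cl w'' ->
  \sum_(w' : tab | cl w' == cl w'') zeta s w w' * zeta t w' w'' = zeta (s * t)%g w w''.
Proof.
move=> ww; rewrite /zeta.
under eq_bigr do rewrite big_distrlr /=.
rewrite exchange_big /=; under eq_bigr do rewrite exchange_big /=.
under eq_bigr => u _ do under eq_bigr => v _ do rewrite gcoef_mul //.
rewrite exchange_big /= !sum_le.
under eq_bigr => A _ do rewrite sum_le.
rewrite (eq_bigr (fun A => if ran (res t A) \subset pdom s
   then gcoef (res (s * t)%g A) (val w) (val w'') else 0)) => [|A At].
  by rewrite -big_mkcondr /=; apply: eq_bigl => A; rewrite ran_res_sub.
case: ifP => h.
  rewrite (bigD1 (ran (res t A))) //= big1 ?addr0.
    by rewrite pdom_res (finset.setIidPl h) eqxx res_mul.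
  move=> B /andP[Bs /negPf nB]; rewrite pdom_res (finset.setIidPl Bs) nB //.
rewrite big1 // => B Bs; rewrite pdom_res (finset.setIidPl Bs).
by case: eqP => // e; move: h; rewrite -e Bs.
Qed.

Lemma zeta_moebius s w w' :
  \sum_(t | rook_le t s) (-1) ^+ (rank s - rank t) * zeta t w w' =
  gcoef s (val w) (val w').
Proof.
rewrite sum_le; under eq_bigr => A As do rewrite /zeta sum_le pdom_res (finset.setIidPl As) big_distrr /=.
under eq_bigr => A As do under eq_bigr => B BA do rewrite (res_res s BA).
rewrite (exchange_big_dep (fun B => B \subset pdom s)) /=; last first.
  by move=> A B As BA; apply: fintype.subset_trans BA As.
rewrite (eq_bigr (fun B => (B == pdom s)%:R * gcoef (res s B) (val w) (val w'))).
  rewrite (bigD1 (pdom s)) //= eqxx mul1r res_id big1 ?addr0 // => B /andP[_ /negPf ->].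
  by rewrite mul0r.
move=> B Bs; rewrite -(alternating_sum K Bs) big_distrl /=.
apply: eq_big => [A|A /andP[As _]]; first by rewrite andbC.
by rewrite /rank pdom_res (finset.setIidPl As).
Qed.

(** Rooks with given domain and range are distinguished by their codes ([code_inj]), so the inner
    sum has at most one term and one block is a transform on a symmetric group. *)
Lemma sum_gcoef (g : rook n -> K) p q :
  \sum_t g t * gcoef t p q = fourier #|q.1|
    (fun c => \sum_(u : rook n | [&& pdom u == q.1, ran u == p.1 & code u == c]) g u)
    p.2 q.2.
Proof.
rewrite /fourier; under [RHS]eq_bigr do rewrite big_distrl /=.
rewrite (exchange_big_dep (fun u : rook n => (pdom u == q.1) && (ran u == p.1))) /=; last first.
  by move=> c u _ /and3P[-> -> _].
rewrite (bigID (fun u : rook n => (pdom u == q.1) && (ran u == p.1))) /= addrC.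
rewrite [X in X + _]big1 ?add0r => [|u nu]; last by rewrite /gcoef /= ifN ?mulr0.
apply: eq_bigr => u /andP[e1 e2]; rewrite /gcoef /= e1 e2.
rewrite -big_filter (bigD1_seq (code u)) ?filter_uniq ?uniq_codes //=.
  rewrite big_filter_cond big1 ?addr0 // => c /andP[/eqP ->]; by rewrite eqxx.
by rewrite mem_filter eqxx -(eqP e1) code_codes.
Qed.

Lemma gcoef_indep (g : rook n -> K) :
  (forall w w', cl w = cl w' -> \sum_t g t * gcoef t (val w) (val w') = 0) ->
  forall t, g t = 0.
Proof.
move=> h t; have kn : (rank t <= n)%N by rewrite -[leqRHS]card_ord max_card.
pose phi c := \sum_(u : rook n | [&& pdom u == pdom t, ran u == ran t & code u == c]) g u.
have <- : phi (code t) = g t.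
  rewrite /phi (bigD1 t) ?eqxx //= big1 ?addr0 // => u.
  case/andP => /and3P[/eqP e1 /eqP e2 /eqP e3] /eqP; case.
  exact: code_inj.
apply: (fourier_inj kn _ (code_codes t)) => l P Q hP hQ.
have mT B R : #|B| = rank t -> R \in paths n (rank t) l -> (B, R) \in tableaux.
  by move=> e; rewrite mem_tableaux e paths_allpaths => /andP[].
have hw := mT _ _ (card_ran t) hP; have hw' := mT _ _ (erefl : #|pdom t| = rank t) hQ.
have := h (SeqSub hw) (SeqSub hw').
rewrite /cl /=; move: (hP) (hQ); rewrite !paths_allpaths => /andP[_ /eqP ->] /andP[_ /eqP ->].
by move=> /(_ erefl) <-; rewrite sum_gcoef.
Qed.

Lemma card_rook_ge : (\sum_(A : {set 'I_n}) n ^_ #|A| <= #|{: rook n}|)%N.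
Proof.
rewrite -sum1_card (partition_big (fun s : rook n => pdom s) xpredT) //=.
apply: leq_sum => A _; apply: leq_trans (card_pdom_eq A) _.
by rewrite sum1dep_card.
Qed.

(** The left side is the sum of the squared dimensions. A tableau on k elements shares its shape
    with C(n, k) times the degree many; summed over the tableaux on one subset this gives C(n, k)
    k!, the number of injections of that subset. *)
Lemma card_tab_pairs :
  (#|[set p : tab * tab | cl p.1 == cl p.2]| <= #|{: rook n}|)%N.
Proof.
apply: leq_trans card_rook_ge.
rewrite -sum1dep_card -(pair_big_dep xpredT (fun w w' : tab => cl w == cl w') (fun _ _ => 1%N)) /=.
rewrite (eq_bigr (fun w : tab => 'C(n, #|(val w).1|) *
    size (paths n #|(val w).1| (endpt n (val w).2)))%N) => [|w _].
  rewrite (sum_tab_cond xpredT (fun q => ('C(n, #|q.1|) *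
    size (paths n #|q.1| (endpt n q.2)))%N)) /=.
  apply: leq_sum => A _; rewrite -big_distrr /= sum_allpaths.
    by rewrite -bin_ffact leqnn.
 by rewrite -[leqRHS]card_ord max_card.
under eq_bigl do rewrite eq_sym.
have <- : #|[set B : {set 'I_n} | #|B| == #|(val w).1|]| = 'C(n, #|(val w).1|).
  by rewrite card_draws card_ord.
rewrite (sum_tab _ (fun=> 1%N)) -sum1dep_card big_distrl /=.
rewrite [RHS]big_mkcond /=; apply: eq_bigr => B _.
rewrite sum1_size; case: eqP => [-> //|nB]; first by rewrite mul1n.
case e: (paths n #|B| (cl w)) => [|R s] //.
have /paths_good[_ _ i1] : R \in paths n #|B| (cl w) by rewrite e mem_head.
by have /paths_good[_ _ i2] := tab_path w; case: nB; rewrite -i1 -i2.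
Qed.

End Coefficients.

(** * Irreducible representations *)

Section Complete.
Variables (K : numClosedFieldType) (n : nat).
Local Notation A := (rook_algebra K n).
Local Notation tab := (tab n).
Implicit Types (s t u : rook n) (l : seq bool) (w v : tab) (a b f : A).

Definition phi f w w' : K := \sum_s f s * zeta K s w w'.

Lemma phi_linear w w' c a b : phi (c *: a + b) w w' = c * phi a w w' + phi b w w'.
Proof.
rewrite /phi big_distrr -big_split; apply: eq_bigr => s _ /=.
by rewrite !ffunE mulrDl -mulrA.
Qed.

Lemma phi0 w w' : phi 0 w w' = 0.
Proof. by rewrite /phi big1 // => s _; rewrite ffunE mul0r. Qed.

Lemma phi_sum (J : Type) (r : seq J) (p : pred J) (c : J -> K) (g : J -> A) w w' :
  phi (\sum_(j <- r | p j) c j *: g j) w w' = \sum_(j <- r | p j) c j * phi (g j) w w'.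
Proof.
elim: r => [|j r IH]; first by rewrite !big_nil phi0.
by rewrite !big_cons; case: (p j) => //; rewrite phi_linear IH.
Qed.

Lemma phi_basis s w w' : phi (rook_basis K s) w w' = zeta K s w w'.
Proof.
rewrite /phi (bigD1 s) //= ffunE eqxx mul1r big1 ?addr0 // => t /negPf ts.
by rewrite ffunE ts mul0r.
Qed.

Lemma phi_groupoid s w w' : phi (groupoid_basis K s) w w' = gcoef K s (val w) (val w').
Proof.
rewrite /groupoid_basis phi_sum -zeta_moebius; apply: eq_bigr => t _.
by rewrite phi_basis.
Qed.

Lemma phi_mul a b w w'' : cl w = cl w'' ->
  phi (a * b) w w'' = \sum_(w' | cl w' == cl w'') phi a w w' * phi b w' w''.
Proof.
move=> ww; rewrite -[a * b]/(alg_mul a b) /alg_mul pair_big phi_sum /=.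
under [RHS]eq_bigr do rewrite /phi big_distrlr pair_big /=.
rewrite exchange_big; apply: eq_bigr => -[s t] _ /=.
rewrite phi_basis -zeta_mul // big_distrr; apply: eq_bigr => w' _ /=.
by rewrite mulrACA.
Qed.

Lemma rook_leP t s : rook_le t s -> t = res s (pdom t) /\ pdom t \subset pdom s.
Proof.
move=> /forall_inP h; split.
  apply: rookP => x; rewrite resE; case: ifP => hx; first exact/eqP/h.
  by move: hx; rewrite mem_pdom => /negbFE/eqP.
apply/fintype.subsetP => x xt; have := h x xt; move: xt; rewrite !mem_pdom.
by move=> xt /eqP <-.
Qed.

Lemma phi_inj a : (forall w w', cl w = cl w' -> phi a w w' = 0) -> a = 0.
Proof.
(* These sums are the coefficients of [a] in the groupoid basis. *)
move=> h; have g0 t : \sum_(s | rook_le t s) a s = 0.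
  apply: (@gcoef_indep K n (fun t => \sum_(s | rook_le t s) a s)) => w w' ww.
  rewrite -[RHS](h _ _ ww) /phi /zeta.
  under eq_bigr do rewrite big_distrl /=.
  under [RHS]eq_bigr do rewrite big_distrr /=.
  by rewrite (exchange_big_dep xpredT).
(* The system is unitriangular: descending induction on the rank kills every rook strictly above
   [s]. *)
suff H m s : (n - rank s < m)%N -> a s = 0.
  by apply/ffunP => s; rewrite ffunE (H (n - rank s).+1).
elim: m s => // m IH s hm; have := g0 s; rewrite (bigD1 s) /=; last first.
  by apply/forall_inP => x _; rewrite eqxx.
rewrite big1 ?addr0 // => u /andP[/rook_leP[su sub] us]; apply: IH.
have : (rank s < rank u)%N.
  rewrite /rank ltn_neqAle subset_leq_card // andbT; apply: contraNneq us => e.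
  by rewrite su; have /eqP -> : pdom s == pdom u; rewrite ?res_id // finset.eqEcard sub e /=.
have : (rank u <= n)%N by rewrite -[leqRHS]card_ord max_card.
by lia.
Qed.

Lemma phi_ext a b : (forall w w', cl w = cl w' -> phi a w w' = phi b w w') -> a = b.
Proof.
move=> h; apply/eqP; rewrite -subr_eq0; apply/eqP/phi_inj => w w' ww.
by rewrite addrC -scaleN1r phi_linear h // mulN1r addNr.
Qed.

(** Injectivity makes the rank equal to the number of rows, and by [card_tab_pairs] there are no
    more columns than rows. *)
Lemma phi_surj (g : tab -> tab -> K) :
  exists a, forall w w', cl w = cl w' -> phi a w w' = g w w'.
Proof.
pose Z : finType := {p : tab * tab | cl p.1 == cl p.2}.
pose M : 'M[K]_(#|{: rook n}|, #|Z|) :=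
  \matrix_(i, j) zeta K (enum_val i) (val (enum_val j)).1 (val (enum_val j)).2.
pose alg (v : 'rV[K]_#|{: rook n}|) : A := [ffun s => v 0 (enum_rank s)].
have ME (v : 'rV_#|{: rook n}|) (z : Z) : (v *m M) 0 (enum_rank z) = phi (alg v) (val z).1 (val z).2.
  rewrite mxE /phi (reindex (@enum_rank (rook n))) /=; last first.
    by apply: onW_bij; exact: enum_rank_bij.
  by apply: eq_bigr => s _; rewrite !mxE !enum_rankK ffunE.
have free : row_free M.
  apply: inj_row_free => v vM; have a0 : alg v = 0.
    apply: phi_inj => w w' /eqP ww; have := ME v (exist _ (w, w') ww).
    by rewrite vM mxE /= => <-.
  apply/rowP => i; rewrite mxE -(enum_valK i).
  by have := congr1 (fun b : A => b (enum_val i)) a0; rewrite !ffunE.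
have /row_fullP[B BM] : row_full M.
  rewrite /row_full eqn_leq rank_leq_col (eqP free).
  apply: leq_trans (card_tab_pairs n); rewrite card_sig subset_leq_card //.
  by apply/fintype.subsetP => p; rewrite !inE.
exists (alg (\row_j g (val (enum_val j)).1 (val (enum_val j)).2 *m B)) => w w' /eqP ww.
have := ME (\row_j g (val (enum_val j)).1 (val (enum_val j)).2 *m B) (exist _ (w, w') ww).
by rewrite /= -mulmxA BM mulmx1 mxE enum_rankK /= => <-.
Qed.

Definition cls l : {set tab} := [set w | cl w == l].

Definition rep_fun l a : 'M[K]_#|cls l| := \matrix_(i, j) phi a (enum_val i) (enum_val j).

Fact rep_fun_linear l : linear (rep_fun l).
Proof. by move=> c a b; apply/matrixP => i j; rewrite !mxE phi_linear. Qed.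

HB.instance Definition _ l :=
  GRing.isLinear.Build K A 'M[K]_#|cls l| _ (rep_fun l) (rep_fun_linear l).

Lemma cl_enum l (i : 'I_#|cls l|) : cl (enum_val i) = l.
Proof. by have := enum_valP i; rewrite inE => /eqP. Qed.

Lemma sum_cls (V : nmodType) l (F : tab -> V) :
  \sum_(w | cl w == l) F w = \sum_(i < #|cls l|) F (enum_val i).
Proof. by rewrite -(big_enum_val F); apply: eq_bigl => w; rewrite inE. Qed.

Fact rep_funM l : {morph rep_fun l : a b / a * b >-> a *m b}.
Proof.
move=> a b; apply/matrixP => i j; rewrite !mxE phi_mul ?cl_enum // sum_cls.
by apply: eq_bigr => k _; rewrite !mxE.
Qed.

Definition rep l : mxrep K n := MxRep (mxrep_fun := rep_fun l) (@rep_funM l).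

Lemma rep_surj l (N : 'M[K]_#|cls l|) : exists a, rep l a = N.
Proof.
have [a ha] := phi_surj (fun w w' =>
  \sum_i \sum_j N i j * ((w == enum_val i) && (w' == enum_val j))%:R).
exists a; apply/matrixP => i j; rewrite mxE ha ?cl_enum // (bigD1 i) //= (bigD1 j) //=.
rewrite !eqxx mulr1 !big1 ?addr0 // => k.
  by move=> ki; rewrite big1 // => m _; rewrite (inj_eq enum_val_inj) eq_sym (negPf ki) mulr0.
by move=> kj; rewrite (inj_eq enum_val_inj) eq_sym (negPf kj) andbF mulr0.
Qed.

Lemma rep_irr w : mxrep_irr (rep (cl w)).
Proof.
have hw : w \in cls (cl w) by rewrite inE.
pose i := enum_rank_in hw w; split.
  have [a ha] := rep_surj (1%:M : 'M[K]_#|cls (cl w)|).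
  exists a, (delta_mx i 0); rewrite ha mul1mx.
  by apply/eqP => /matrixP/(_ i 0)/eqP; rewrite !mxE !eqxx oner_eq0.
split; first by rewrite /=; apply/card_gt0P; exists w.
move=> U sU; case: (eqVneq U 0%VS) => [|U0]; [by left|right].
have vU := memv_pick U; have : vpick U != 0 by rewrite vpick0.
case/cV0Pn => k vk; apply/eqP; rewrite eqEsubv subvf /=.
(* The chosen rank-one matrix carries the nonzero vector [vpick U] to an arbitrary [y]. *)
apply/subvP => y _; have [a ha] := rep_surj (y *m ((vpick U k 0)^-1 *: delta_mx 0 k)).
have := sU a _ vU; rewrite ha -mulmxA -scalemxAl -rowE.
rewrite (_ : _ *: _ = 1%:M) ?mulmx1 //.
by apply/matrixP => p q; rewrite !ord1 !mxE mulVf.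
Qed.

Lemma exists_units : exists E : tab -> tab -> A, forall w w' v v', cl v = cl v' ->
  phi (E w w') v v' = ((v == w) && (v' == w'))%:R.
Proof.
have [E hE] := choice (fun p : tab * tab =>
  phi_surj (fun v v' => ((v == p.1) && (v' == p.2))%:R)).
by exists (fun w w' => E (w, w')) => w w' v v'; exact: hE.
Qed.

Definition irr_reps : set (mxrep K n) := [set sigma | exists w, sigma = rep (cl w)]%classic.

Lemma irr_reps_complete : complete_irr_set irr_reps.
Proof.
split=> [_ [w ->]|rho [[a [x ax]] [_ simple]]]; first exact: rep_irr.
have [E hE] := exists_units.
have mulE b w w' : cl w = cl w' -> b * E w w' = \sum_(v | cl v == cl w) phi b v w *: E v w'.
  move=> ww; apply: phi_ext => v v' vv; rewrite phi_mul // phi_sum.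
  rewrite (eq_bigr (fun u : tab => phi b v u * ((u == w) && (v' == w'))%:R)); last first.
    by move=> u /eqP uv; rewrite hE.
  under [RHS]eq_bigr do rewrite hE //.
  case: (eqVneq v' w') => [e|_]; last first.
    by rewrite !big1 // => u _; rewrite andbF mulr0.
  rewrite e (bigD1 w) ?ww //= eqxx mulr1 big1 ?addr0 => [|u /andP[_ /negPf ->]]; last first.
    by rewrite mulr0.
  rewrite (bigD1 v) /= ?vv ?e // eqxx mulr1 big1 ?addr0 // => u /andP[_].
  by rewrite eq_sym => /negPf ->; rewrite mulr0.
have mulEE w w' w'' : cl w = cl w' -> cl w' = cl w'' -> E w w' * E w' w'' = E w w''.
  move=> ww ww'; rewrite mulE // (bigD1 w) ?ww //= hE // !eqxx scale1r big1 ?addr0 //.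
  by move=> u /andP[/eqP uw /negPf nu]; rewrite hE // nu scale0r.
have decE b : b = \sum_(p : tab * tab | cl p.1 == cl p.2) phi b p.1 p.2 *: E p.1 p.2.
  apply: phi_ext => v v' vv; rewrite phi_sum (bigD1 (v, v')) /= ?vv // hE // !eqxx mulr1.
  rewrite big1 ?addr0 // => -[u u'] /andP[/= _ nu]; rewrite hE //.
  by move: nu; rewrite eq_sym xpair_eqE => /negPf ->; rewrite mulr0.
(* If every diagonal unit killed every vector, then so would each [E w w'], equal to
   [E w w' * E w' w'], and hence [a]. *)
have [w1 [x1 hx]] : exists w, exists x : 'cV_(mxrep_dim rho), rho (E w w) *m x != 0.
  apply: contrapT => no; move/eqP: ax; apply.
  rewrite (decE a) linear_sum mulmx_suml big1 // => -[w w'] /= /eqP ww.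
  rewrite linearZ -scalemxAl -(mulEE w w' w') // mxrepM -mulmxA.
  have -> : rho (E w' w') *m x = 0.
    by apply/eqP/negPn/negP => h; apply: no; exists w', x.
  by rewrite mulmx0 scaler0.
have h1 : w1 \in cls (cl w1) by rewrite inE.
pose l := cl w1; pose i1 : 'I_#|cls l| := enum_rank_in h1 w1.
have v1 : enum_val i1 = w1 by rewrite enum_rankK_in.
(* The orbit of [x1] under the units of column [w1] reproduces the column module of [rep l]. *)
pose Q := \matrix_(i < mxrep_dim rho, j < #|cls l|) (rho (E (enum_val j) w1) *m x1) i 0.
have RQ b : rho b *m Q = Q *m rep l b.
  apply/matrixP => i j.
  transitivity ((rho b *m (rho (E (enum_val j) w1) *m x1)) i 0).
    by rewrite mxE [RHS]mxE; apply: eq_bigr => m _; rewrite [Q _ _]mxE.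
  rewrite mulmxA -mxrepM mulE ?cl_enum // linear_sum mulmx_suml summxE sum_cls mxE.
  apply: eq_bigr => k _; rewrite linearZ -scalemxAl mxE mulrC.
  by rewrite [Q _ _]mxE [rep l b _ _]mxE.
have colQ : Q *m delta_mx i1 0 = rho (E w1 w1) *m x1.
  by rewrite -colE; apply/colP => i; rewrite !mxE v1.
(* The unit [E w1 (enum_val k)] isolates coordinate [k] of [c] as a multiple of the nonzero vector
   [rho (E w1 w1) *m x1]. *)
have injQ (c : 'cV_#|cls l|) : Q *m c = 0 -> c = 0.
  move=> Qc; apply/colP => k; rewrite [RHS]mxE.
  have e : rep l (E w1 (enum_val k)) = delta_mx i1 k.
    apply/matrixP => i j; rewrite !mxE hE ?cl_enum // -{1}v1.
    by rewrite !(inj_eq enum_val_inj).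
  have := congr1 (fun y => rho (E w1 (enum_val k)) *m y) Qc.
  rewrite mulmx0 mulmxA RQ -mulmxA e -(mul_delta_mx (0 : 'I_1) i1 k) -mulmxA -rowE.
  rewrite [row k c]mx11_scalar mul_mx_scalar -scalemxAr colQ mxE => /eqP.
  by rewrite scaler_eq0 (negPf hx) orbF => /eqP.
have surjQ (y : 'cV_(mxrep_dim rho)) : exists c : 'cV_#|cls l|, y = Q *m c.
  pose U := limg (linfun (mulmx Q : 'cV_#|cls l| -> 'cV_(mxrep_dim rho))).
  have memU c : Q *m c \in U.
    by have := memv_img (linfun (mulmx Q : 'cV_#|cls l| -> _)) (memvf c); rewrite lfunE.
  have [|U0|U1] := simple U.
  - by move=> b _ /memv_imgP[c _ ->]; rewrite lfunE /= mulmxA RQ -mulmxA.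
  - by have := memU (delta_mx i1 0); rewrite U0 memv0 colQ (negPf hx).
  have : y \in U by rewrite U1 memvf.
  by case/memv_imgP => c _ ->; exists c; rewrite lfunE.
have [c hc] := choice (fun j : 'I_(mxrep_dim rho) => surjQ (delta_mx j 0)).
pose P := \matrix_(i, j) c j i 0.
have QP : Q *m P = 1%:M.
  apply/matrixP => i j; transitivity ((Q *m c j) i 0).
    by rewrite mxE [RHS]mxE; apply: eq_bigr => m _; rewrite [P _ _]mxE.
  by rewrite -hc !mxE eqxx andbT.
have PQ : P *m Q = 1%:M.
  apply/eqP; rewrite -subr_eq0; apply/eqP/matrixP => i j.
  have /colP/(_ i) : col j (P *m Q - 1%:M) = 0.
    by apply: injQ; rewrite colE mulmxA mulmxBr mulmxA QP mul1mx mulmx1 subrr mul0mx.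
  by rewrite !mxE.
exists (rep l); split.
  split; first by exists w1.
  by exists P, Q; split=> // b; rewrite -mulmxA RQ mulmxA PQ mul1mx.
(* Shapes are told apart by [E w1 w1]: it acts nontrivially through [rho] but vanishes in the
   representation of any other shape. *)
move=> _ [[w' ->] [P' [Q' [PQ' QP' h]]]]; congr rep; apply: contrapT => ww.
have z : rep (cl w') (E w1 w1) = 0.
  apply/matrixP => i j; rewrite !mxE hE ?cl_enum //.
  case: eqP => // e; case: ww; rewrite /l -e cl_enum //.
move/eqP: hx; apply; rewrite -[rho _]mul1mx -QP' -(mulmx1 (Q' *m P' *m _)) -QP'.
by rewrite mulmxA -(mulmxA Q') -(mulmxA Q') -h z mulmx0 !mul0mx.
Qed.

Lemma fourier_rep (f : rook n -> K) l i j :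
  groupoid_fourier f (rep l) i j =
  \sum_s f s * gcoef K s (val (enum_val i)) (val (enum_val j)).
Proof.
rewrite /groupoid_fourier summxE; apply: eq_bigr => s _.
by rewrite !mxE phi_groupoid.
Qed.

End Complete.

(** * Assembling the program, the minimum and the asymptotic bound *)

Lemma exists_minimum (S : nat -> Prop) k :
  S k -> exists2 m, is_minimum S m & (m <= k)%N.
Proof.
move=> Sk; have ex : exists k, `[< S k >] by exists k; apply/asboolP.
case: (ex_minnP ex) => m /asboolP Sm hm; exists m; last exact/hm/asboolP.
by split=> // j Sj; apply/hm/asboolP.
Qed.

Lemma card_rook_exp n : (2 ^ n <= #|{: rook n}|)%N.
Proof.
apply: leq_trans (card_rook_ge n).
have -> : (2 ^ n = \sum_(A : {set 'I_n}) 1)%N.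
  rewrite sum1_card -[in LHS](card_ord n) -cardsT -card_powerset; apply: eq_card => A.
  by rewrite powersetE finset.subsetT.
by apply: leq_sum => A _; rewrite ffact_gt0 -[leqRHS]card_ord max_card.
Qed.

Lemma fourier_program (K : numClosedFieldType) n :
  exists2 P : seq (instruction (rook n) K),
    computes_fourier (@irr_reps K n) P & (size P <= 3 * n ^ 2 * #|{: rook n}|)%N.
Proof.
pose phi (p : {set 'I_n} * {set 'I_n}) c (f : rook n -> K) :=
  \sum_(u : rook n | [&& pdom u == p.1, ran u == p.2 & code u == c]) f u.
(* At most one rook has these data, so the sum is an input or 0 and splitting [f] into blocks is
   free. *)
have avail_phi p c P : avail P (phi p c).
  case: (pickP (fun u : rook n => [&& pdom u == p.1, ran u == p.2 & code u == c])).
    move=> u hu; exists (Input u) => f; rewrite /phi (bigD1 u) //= big1 ?addr0 // => t.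
    case/andP => /and3P[/eqP e1 /eqP e2 /eqP e3] /eqP; case.
    case/and3P: hu => /eqP d1 /eqP d2 /eqP d3.
    by apply: code_inj; rewrite ?e1 ?e2 ?e3.
  by move=> h; exists (Const 0) => f; rewrite /phi big_pred0.
pose Q := [pred p : {set 'I_n} * {set 'I_n} | #|p.1| == #|p.2|].
have kn (A : {set 'I_n}) : (#|A| <= n)%N by rewrite -[leqRHS]card_ord max_card.
have r : reach (\sum_(p <- enum Q) (0 + 3 * #|p.1| ^ 2 * (#|p.1|)`!)) (fun=> False)
    (fun psi => exists2 p, p \in enum Q & exists l P R,
      [/\ P \in paths n #|p.1| l, R \in paths n #|p.1| l &
        psi = fun f => fourier #|p.1| (fun c => phi p c f) P R]).
  apply: reach_sum => p _; apply: (reach_trans _ (@reach_fourier _ K n #|p.1| (phi p) (kn p.1))).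
  by apply: reach_free => P _ _ [c _ ->].
have [|P sP hP] := r [::]; first by [].
exists P; last first.
  apply: leq_trans sP _; rewrite big_enum /=.
  rewrite -(pair_big_dep xpredT (fun A B : {set 'I_n} => #|A| == #|B|)
    (fun A _ => 0 + 3 * #|A| ^ 2 * (#|A|)`!)%N) /=.
  apply: leq_trans (leq_mul (leqnn _) (card_rook_ge n)); rewrite big_distrr /=.
  apply: leq_sum => A _; rewrite sum_nat_cond_const add0n.
  have -> : #|[set B : {set 'I_n} | #|A| == #|B|]| = 'C(n, #|A|).
    transitivity #|[set B : {set 'I_n} | #|B| == #|A|]|; last by rewrite card_draws card_ord.
    by apply: eq_card => B; rewrite !inE eq_sym.
  rewrite -bin_ffact /= [leqRHS]mulnCA; do 3! apply: leq_mul => //.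
  by rewrite leq_sqr.
move=> _ [w ->] i j.
pose u := val (enum_val i); pose v := val (enum_val j).
have hu : u.2 \in paths n #|u.1| (cl w) by have := tab_path (enum_val i); rewrite cl_enum.
have hv : v.2 \in paths n #|v.1| (cl w) by have := tab_path (enum_val j); rewrite cl_enum.
have uv : #|u.1| = #|v.1|.
  by have [_ _ <-] := paths_good hu; have [_ _ <-] := paths_good hv.
have [|o ho] := hP (fun f => fourier #|v.1| (fun c => phi (v.1, u.1) c f) u.2 v.2).
  exists (v.1, u.1); first by rewrite mem_enum inE /= uv.
  by exists (cl w), u.2, v.2; rewrite -{1}uv.
by exists o => f; rewrite fourier_rep ho sum_gcoef.
Qed.

Lemma rook_complexity_bound (K : numClosedFieldType) n :
  exists m, rook_complexity K n m /\ (m <= 3 * n ^ 2 * #|{: rook n}|)%N.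
Proof.
have [P cP sP] := fourier_program K n.
have [m1 hm1 le1] : exists2 m, fourier_cost (@irr_reps K n) m & (m <= size P)%N.
  by apply: exists_minimum; exists P.
have [m hm le] : exists2 m, rook_complexity K n m & (m <= m1)%N.
  by apply: exists_minimum; exists (@irr_reps K n) => //; exact: irr_reps_complete.
by exists m; split=> //; apply: leq_trans le (leq_trans le1 sP).
Qed.

Import numFieldNormedType.Exports.
Local Open Scope classical_set_scope.
Local Open Scope ring_scope.

Theorem theorem8p1 (R : realType) :
  exists C : nat -> nat,
    (forall n, rook_complexity R[i] n (C n)) /\
    (fun n => (C n)%:R : R) =O_\oo
      (fun n => #|{: rook n}|%:R * (ln (#|{: rook n}|%:R : R)) ^+ 2 : R).
Proof.
have [C hC] := choice (rook_complexity_bound R[i]).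
exists C; split=> [n|]; first by case: (hC n).
have l2 : 0 < ln (2 : R) by rewrite ln_gt0 // ltr1n.
(* The 3 comes from the bound 3 n^2 |R_n|, and the denominator from n ln 2 <= ln |R_n|, squared. *)
apply/eqO_exP; exists (3 / ln (2 : R) ^+ 2); first by rewrite divr_gt0 ?exprn_gt0.
apply: filterE => n; have [_ le] := hC n.
set N := #|{: rook n}| in le *.
have N1 : (0 < N)%N by apply: leq_trans (card_rook_exp n); rewrite expn_gt0.
have lnN : n%:R * ln 2 <= ln (N%:R : R).
  rewrite mulr_natl -lnXn // ler_ln ?posrE ?exprn_gt0 ?ltr0n //.
  by rewrite -natrX ler_nat card_rook_exp.
have L0 : 0 <= ln (N%:R : R) by rewrite ln_ge0 // ler1n.
rewrite ger0_norm ?ler0n // ger0_norm ?mulr_ge0 ?sqr_ge0 ?ler0n //.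
apply: (@le_trans _ _ (3 * n%:R ^+ 2 * N%:R)).
  by rewrite -natrX -!natrM ler_nat.
have -> : 3 / ln 2 ^+ 2 * (N%:R * ln N%:R ^+ 2) = 3 * (ln N%:R ^+ 2 / ln 2 ^+ 2) * N%:R :> R.
  by field; rewrite gt_eqF.
rewrite ler_wpM2r ?ler0n // ler_wpM2l // ler_pdivlMr ?exprn_gt0 // -exprMn.
by rewrite lerXn2r ?nnegrE ?mulr_ge0 ?ler0n ?(ltW l2).
Qed.
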